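(* Let $f:S^2\to\mathbb{R}^3$ be an injective continuous map. Then the image of $f$ contains the vertices of a tetrahedron that has the symmetry group $D_8$ of a square. That is, there are four distinct points $\xi_1,\xi_2,\xi_3,\xi_4$ on $S^2$ such that $$d(f(\xi_1),f(\xi_2)) = d(f(\xi_2),f(\xi_3)) = d(f(\xi_3),f(\xi_4)) = d(f(\xi_4),f(\xi_1))$$ and $$d(f(\xi_1),f(\xi_3)) = d(f(\xi_2),f(\xi_4)).$$
   Context: Here $S^2$ is the $2$-sphere and $d$ denotes the Euclidean distance on $\mathbb{R}^3$. $D_8$ denotes the dihedral group with $8$ elements. The phrase ''has the symmetry group $D_8$ of a square'' means exactly the displayed equalities of distances between four distinct points. *)

(* Defs.v *)
From HB Require Import structures.
From mathcomp Require Import all_boot all_order all_algebra.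
From mathcomp Require Import all_classical all_reals all_analysis.

Set Implicit Arguments.
Unset Strict Implicit.
Unset Printing Implicit Defensive.

Import Order.TTheory GRing.Theory Num.Theory.
Import numFieldNormedType.Exports.

Local Open Scope classical_set_scope.
Local Open Scope ring_scope.

(* The library's norm on row vectors is the maximum norm, so the Euclidean
   distance is introduced here; both induce the topology of 'rV[R]_n. *)
Definition eucl_dist (R : realType) (n : nat) (x y : 'rV[R]_n) : R :=
  Num.sqrt (\sum_(i < n) (x ord0 i - y ord0 i) ^+ 2).

Definition sphere2 (R : realType) : set 'rV[R]_3 :=
  [set x | eucl_dist x 0 = 1].

Arguments sphere2 R : clear implicits.

(* Main.v *)
Require Import Defs.
From HB Require Import structures.
From mathcomp Require Import all_boot all_order all_algebra.
From mathcomp Require Import all_classical all_reals all_analysis.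
From mathcomp Require Import zify ring lra.

Set Implicit Arguments.
Unset Strict Implicit.
Unset Printing Implicit Defensive.

Import Order.TTheory GRing.Theory Num.Theory.
Import numFieldNormedType.Exports.

Local Open Scope classical_set_scope.
Local Open Scope ring_scope.

(** A tetrahedron with the symmetry of a square has two opposite edges of the
    same length [2 h] whose midpoints are joined by a common perpendicular, and
    four other equal edges.  In particular such a tetrahedron [p1 p2 p3 p4] is
    obtained from a point [m], a chord [p1 p3] with midpoint [m] and length
    [2 h], and two points [p2], [p4] of the plane through [m] orthogonal to this
    chord, at equal distance [r] from [m] and at distance [2 h] from each other:
    the four edges between the two pairs then have length [sqrt (h^2 + r^2)].

    The image of an embedded sphere contains the boundary of a bounded open set
    [V] ([bounded_region]).  Choose any [m] in [V].  The key fact is planar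
    ([boundary_meets_image]): if a bounded open set of the plane contains the
    origin and [T] is a continuous self-map of the plane which preserves the
    distance to the origin, then some point and its image by [T] both lie on the
    boundary of that set.  Applied to slices of [V] by planes through [m], it
    gives

    - for the half turn, a chord of the boundary of [V] with midpoint [m]; by
      compactness there is a shortest one, with ends [m + z] and [m - z], and
      half-length [h];

    - for the map [twist], in the plane through [m] orthogonal to [z], a
      boundary point [y] such that [twist y] is also a boundary point.  This map
      rotates the circle of radius [r] by the angle that moves its points by
      [2 h] if [r >= h], and is the half turn if [r <= h].

    If [y] were at distance less than [h] from [m], it would be the end of a
    chord with midpoint [m] shorter than the shortest one.  So its distance is
    at least [h], the points [y] and [twist y] are at distance [2 h], and
    together with [m + z] and [m - z] they form the required tetrahedron.

    Two topological results carry the proof.  The existence of [V] is the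
    separation half of the Jordan-Brouwer theorem; it is proved with a mod 2
    degree of simplicial approximations, counted by Sperner's lemma.  The planar
    fact rests on the unicoherence of the plane ([unicoherence]), which makes
    the outer boundary of a bounded connected set connected. *)

(** * Parity of finite sums *)
Section Parity.
Local Open Scope nat_scope.

Lemma odd_sum_eq (I : Type) (r : seq I) (F G : I -> nat) :
  (forall i, odd (F i) = odd (G i)) ->
  odd (\sum_(i <- r) F i) = odd (\sum_(i <- r) G i).
Proof.
move=> FG; elim: r => [|i r IH]; first by rewrite !big_nil.
by rewrite !big_cons !oddD FG IH.
Qed.

Lemma odd_sum_telescope (n : nat) (h : nat -> nat) :
  odd (\sum_(i <- iota 0 n) (h i.+1 + h i)) = odd (h n + h 0).
Proof.
elim: n => [|n IH]; first by rewrite big_nil oddD addbb.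
rewrite -addn1 iotaD big_cat /= big_seq1 add0n addn1 !oddD IH oddD.
by case: (odd (h n)); case: (odd (h n.+1)); case: (odd (h 0)).
Qed.

(** Read contrapositively: if an odd number of elements satisfy [P], then one
    of them lies in a class of odd size.  This is how an odd count of cells of
    the domain gets localised over a single cell of the target. *)
Lemma even_count_classes (X : eqType) (s : seq X) (e : rel X) (P : pred X) :
  equivalence_rel e -> (forall x y, e x y -> P x = P y) ->
  (forall x, x \in s -> P x -> ~~ odd (count (e x) s)) ->
  ~~ odd (count P s).
Proof.
move=> eqe eP; elim: {s}(size s) {-2}s (leqnn (size s)) => [|m IH] s.
  by rewrite leqn0 size_eq0 => /eqP ->.
move=> szs ev; have [/hasP[x xs Px]|] := boolP (has P s); last first.
  by rewrite has_count -eqn0Ngt => /eqP ->.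
have exx y : e y y by have [] := eqe y y y.
have split_count Q : count Q s =
    count Q [seq y <- s | e x y] + count Q [seq y <- s | ~~ e x y].
  by rewrite !count_filter -count_predUI -[LHS]addn0; congr (_ + _);
    [apply: eq_count => y /=; case: (Q y); case: (e x y)
    |apply/esym/eqP; rewrite -leqn0 leqNgt -has_count;
     apply/hasPn => y _ /=; case: (Q y); case: (e x y)].
rewrite split_count oddD count_filter.
have -> : count (predI P (e x)) s = count (e x) s.
  apply: eq_count => y /=; case exy: (e x y); last by rewrite andbF.
  by rewrite -(eP _ _ exy) Px.
rewrite (negbTE (ev x xs Px)) addFb; apply: IH.
  rewrite -ltnS; apply: leq_trans szs; rewrite size_filter.
  rewrite -(count_predC (e x) s) -[X in X < _]add0n ltn_add2r -has_count.
  by apply/hasP; exists x.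
move=> y; rewrite mem_filter => /andP[/= nexy ys] Py.
have := ev y ys Py; rewrite split_count oddD.
have -> : count (e y) [seq z <- s | e x z] = 0.
  apply/eqP; rewrite -leqn0 leqNgt -has_count; apply/hasPn => z.
  rewrite mem_filter => /andP[exz _]; apply/negP => eyz; move/negP: nexy; apply.
  have [_ ->//] := eqe x z y; have [_ <-//] := eqe y z y.
by rewrite addFb.
Qed.

End Parity.

(** * The Kuhn triangulation of a cube and its boundary *)
Section Kuhn.
Local Open Scope nat_scope.
Variable X : eqType.
Implicit Types (g : nat -> nat -> nat -> X) (h : nat -> nat -> X).

(** The six tetrahedra of a unit cube are the monotone edge paths from its
    lowest to its highest corner.  A simplex is the list of the labels of its
    vertices, repetitions allowed, so that the same list describes the
    triangulation and its image under a map of the vertices. *)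
Definition cell g i j k : seq (seq X) :=
  [:: [:: g i j k; g i.+1 j k; g i.+1 j.+1 k; g i.+1 j.+1 k.+1];
      [:: g i j k; g i.+1 j k; g i.+1 j k.+1; g i.+1 j.+1 k.+1];
      [:: g i j k; g i j.+1 k; g i.+1 j.+1 k; g i.+1 j.+1 k.+1];
      [:: g i j k; g i j.+1 k; g i j.+1 k.+1; g i.+1 j.+1 k.+1];
      [:: g i j k; g i j k.+1; g i.+1 j k.+1; g i.+1 j.+1 k.+1];
      [:: g i j k; g i j k.+1; g i j.+1 k.+1; g i.+1 j.+1 k.+1]].

Definition kuhn n g : seq (seq X) :=
  [seq t | i <- iota 0 n, t <-
    [seq t | j <- iota 0 n, t <- [seq t | k <- iota 0 n, t <- cell g i j k]]].

Definition faces (t : seq X) : seq (seq X) :=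
  if t is [:: x; y; z; w] then
    [:: [:: y; z; w]; [:: x; z; w]; [:: x; y; w]; [:: x; y; z]]
  else [::].

Definition square h j k : seq (seq X) :=
  [:: [:: h j k; h j.+1 k; h j.+1 k.+1]; [:: h j k; h j k.+1; h j.+1 k.+1]].

Definition sheet (d : seq X -> nat) n h : nat :=
  \sum_(j <- iota 0 n) \sum_(k <- iota 0 n) \sum_(s <- square h j k) d s.

Lemma sum_kuhn (F : seq X -> nat) n g :
  \sum_(t <- kuhn n g) F t =
  \sum_(i <- iota 0 n) \sum_(j <- iota 0 n) \sum_(k <- iota 0 n)
     \sum_(t <- cell g i j k) F t.
Proof.
rewrite /kuhn big_allpairs_dep; apply: eq_bigr => i _.
rewrite big_allpairs_dep; apply: eq_bigr => j _.
by rewrite big_allpairs_dep.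
Qed.

(** Modulo 2, the boundary of the sum of all tetrahedra is the boundary of the
    big cube: a face inside a unit cube belongs to two of its six tetrahedra,
    and a face shared by two unit cubes cancels by telescoping. *)
Lemma kuhn_boundary (d : seq X -> nat) n g :
  odd (\sum_(t <- kuhn n g) \sum_(s <- faces t) d s) =
  odd (sheet d n (fun j k => g n j k) + sheet d n (fun j k => g 0 j k)
     + (sheet d n (fun i k => g i n k) + sheet d n (fun i k => g i 0 k))
     + (sheet d n (fun i j => g i j n) + sheet d n (fun i j => g i j 0))).
Proof.
rewrite sum_kuhn.
pose A i j k := \sum_(s <- square (fun j k => g i j k) j k) d s.
pose B j i k := \sum_(s <- square (fun i k => g i j k) i k) d s.
pose C k i j := \sum_(s <- square (fun i j => g i j k) i j) d s.
rewrite (_ : odd _ = odd (\sum_(i <- iota 0 n) \sum_(j <- iota 0 n)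
   \sum_(k <- iota 0 n) ((A i.+1 j k + A i j k) + (B j.+1 i k + B j i k)
     + (C k.+1 i j + C k i j)))); last first.
  apply: odd_sum_eq => i; apply: odd_sum_eq => j; apply: odd_sum_eq => k.
  rewrite /A /B /C /cell /square /faces !(big_cons, big_nil).
  lia.
under eq_bigr do (under eq_bigr do rewrite !big_split /=).
under eq_bigr do rewrite !big_split /=.
rewrite !big_split /= !oddD; congr (_ (+) _ (+) _).
- rewrite -oddD -!big_split /= /sheet.
  under eq_bigr do (rewrite -big_split /=; under eq_bigr do rewrite -big_split /=).
  rewrite exchange_big /= -oddD -big_split /=; apply: odd_sum_eq => j.
  rewrite exchange_big /= -big_split /=; apply: odd_sum_eq => k.
  exact: (odd_sum_telescope n (fun i => A i j k)).
- rewrite -oddD -!big_split /= /sheet -oddD -big_split /=.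
  apply: odd_sum_eq => i; rewrite -!big_split /=.
  under eq_bigr do rewrite -big_split /=.
  rewrite exchange_big /=; apply: odd_sum_eq => k.
  exact: (odd_sum_telescope n (fun j => B j i k)).
- rewrite -oddD -!big_split /= /sheet -oddD -big_split /=.
  apply: odd_sum_eq => i; rewrite -!big_split /=; apply: odd_sum_eq => j.
  rewrite -big_split /=; exact: (odd_sum_telescope n (fun k => C k i j)).
Qed.

Lemma sheet_boundary (e : X -> X -> nat) n h :
  odd (sheet (fun s => if s is [:: x; y; z] then e y z + e x z + e x y else 0)
     n h) =
  odd (\sum_(k <- iota 0 n) e (h n k) (h n k.+1)
     + \sum_(k <- iota 0 n) e (h 0 k) (h 0 k.+1)
     + (\sum_(j <- iota 0 n) e (h j n) (h j.+1 n)
     + \sum_(j <- iota 0 n) e (h j 0) (h j.+1 0))).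
Proof.
pose A j k := e (h j k) (h j k.+1); pose B k j := e (h j k) (h j.+1 k).
rewrite (_ : odd _ = odd (\sum_(j <- iota 0 n) \sum_(k <- iota 0 n)
   ((A j.+1 k + A j k) + (B k.+1 j + B k j)))); last first.
  apply: odd_sum_eq => j; apply: odd_sum_eq => k.
  rewrite /A /B /square !(big_cons, big_nil); lia.
under eq_bigr do rewrite !big_split /=.
rewrite !big_split /= !oddD; congr (_ (+) _).
- rewrite -oddD -!big_split /= -oddD -big_split /=.
  under eq_bigr do rewrite -big_split /=.
  rewrite exchange_big /=; apply: odd_sum_eq => k.
  exact: (odd_sum_telescope n (fun j => A j k)).
- rewrite -oddD -!big_split /= -oddD -big_split /=.
  apply: odd_sum_eq => j; rewrite -!big_split /=.
  exact: (odd_sum_telescope n (fun k => B k j)).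
Qed.

Lemma sheet_avoid (f : seq X) n h a : a \in f ->
  (forall j k, j <= n -> k <= n -> h j k != a) ->
  sheet (fun s => perm_eq s f : nat) n h = 0.
Proof.
move=> af ha; rewrite /sheet big_seq big1// => j.
rewrite mem_iota add0n => /= jn; rewrite big_seq big1// => k.
rewrite mem_iota add0n => /= kn; rewrite big_seq big1// => s.
rewrite !inE => sE.
have as_ : a \notin s.
  have h00 := negbTE (ha _ _ (ltnW jn) (ltnW kn)).
  have h10 := negbTE (ha _ _ jn (ltnW kn)).
  have h01 := negbTE (ha _ _ (ltnW jn) kn).
  have h11 := negbTE (ha _ _ jn kn).
  by case/orP: sE => /eqP ->; rewrite !inE ![a == _]eq_sym h00 h11 ?h10 ?h01.
by apply/eqP; rewrite eqb0; apply: contra as_ => /perm_mem ->.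
Qed.

Lemma mem_kuhn n g t : t \in kuhn n g ->
  exists i j k, [/\ i < n, j < n, k < n & forall x, x \in t ->
    exists a b c : bool, x = g (i + a) (j + b) (k + c)].
Proof.
case/allpairsPdep => i [? [iI /allpairsPdep[j [? [jI /allpairsPdep[k [u [kI + ->]]] ->]]] ->]].
rewrite !mem_iota !add0n in iI jI kI => uc; exists i, j, k; split => // x.
have vtx (a b c : bool) i' j' k' : i' = i + a -> j' = j + b -> k' = k + c ->
    x = g i' j' k' -> exists a b c : bool, x = g (i + a) (j + b) (k + c).
  by move=> -> -> -> ->; exists a, b, c.
have [p1 p0] : (forall m, m.+1 = m + true) /\ forall m, m = m + false.
  by split=> m; rewrite ?addn1 ?addn0.
by move: uc; rewrite !inE => /or4P[|||/or3P[]] /eqP ->; rewrite !inE => /or4P[] /eqP;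
  apply: vtx; (apply: p0 || apply: p1).
Qed.

Lemma size_kuhn n g t : t \in kuhn n g -> size t = 4.
Proof.
case/allpairsPdep => i [? [_ /allpairsPdep[j [? [_ /allpairsPdep[k [u [_ + ->]]] ->]]] ->]].
by rewrite !inE; do 5?[case/orP => [/eqP ->//|]]; move/eqP => ->.
Qed.

(** The face opposite to [p] is [f] up to order exactly when the whole
    tetrahedron is [p :: f] up to order. *)
Lemma faces_count (t f : seq X) : size t = 4 ->
  \sum_(s <- faces t) (perm_eq s f : nat) = count (fun p => perm_eq t (p :: f)) t.
Proof.
case: t => [|x [|y [|z [|w [|]]]]]//= _.
rewrite !big_cons big_nil /=.
have px : perm_eq [:: x; y; z; w] =1 perm_eq [:: x; y; z; w] by [].
have py : perm_eq [:: x; y; z; w] =1 perm_eq [:: y; x; z; w].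
  by apply/permPl; rewrite (perm_catCA [:: x] [:: y]).
have pz : perm_eq [:: x; y; z; w] =1 perm_eq [:: z; x; y; w].
  by apply/permPl; rewrite (perm_catCA [:: x; y] [:: z]).
have pw : perm_eq [:: x; y; z; w] =1 perm_eq [:: w; x; y; z].
  by apply/permPl; rewrite (perm_catC [:: x; y; z] [:: w]).
by rewrite (py (y :: f)) (pz (z :: f)) (pw (w :: f)) !perm_cons.
Qed.

(** If [t] is [f] together with a repetition of one of its vertices, then two
    faces of [t] are equal to [f]; degenerate simplices thus contribute nothing
    modulo 2. *)
Lemma odd_faces_count (t f : seq X) : size t = 4 -> uniq f ->
  odd (\sum_(s <- faces t) (perm_eq s f : nat)) =
  has (fun p => (p \notin f) && perm_eq t (p :: f)) t.
Proof.
move=> st uf; rewrite faces_count//.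
have [/hasP[p pt ptf]|hN] := boolP (has (fun p => perm_eq t (p :: f)) t); last first.
  rewrite (_ : count _ _ = 0); last by apply/eqP; rewrite -leqn0 leqNgt -has_count.
  by apply/esym/negbTE; apply: contra hN => /hasP[p pt /andP[_ ?]]; apply/hasP; exists p.
have E q : perm_eq t (q :: f) = (q == p).
  rewrite (permPl ptf); apply/idP/eqP => [pq|->//].
  by move/permP/(_ (pred1 q)): pq; rewrite /= eqxx eq_sym; case: eqP => //; lia.
rewrite (eq_count E) (permP ptf) /= eqxx count_uniq_mem//.
have -> : odd (1 + (p \in f)) = (p \notin f) by case: (p \in f).
apply/idP/hasP => [pf|[q qt]]; first by exists p; rewrite ?pf.
by rewrite E => /andP[qf /eqP <-].
Qed.

End Kuhn.

Lemma map_kuhn (X Y : eqType) (l : X -> Y) n (g : nat -> nat -> nat -> X) :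
  kuhn n (fun i j k => l (g i j k)) = map (map l) (kuhn n g).
Proof.
rewrite /kuhn /allpairs_dep map_flatten -map_comp; congr flatten.
apply: eq_map => i /=; rewrite !map_id map_flatten -map_comp; congr flatten.
apply: eq_map => j /=; rewrite !map_id map_flatten -map_comp; congr flatten.
Qed.

(** * Sperner's lemma for the cube *)
Section Sperner.
Local Open Scope nat_scope.

Let rainbow_faces (t : seq nat) : size t = 4 -> all (fun x => x < 4) t ->
  odd (\sum_(s <- faces t) (perm_eq s [:: 0; 1; 2] : nat)) =
  perm_eq t [:: 0; 1; 2; 3].
Proof.
case: t => [|x [|y [|z [|w [|]]]]]//= _.
rewrite !big_cons big_nil /=.
case: x => [|[|[|[|]]]]//; case: y => [|[|[|[|]]]]//;
case: z => [|[|[|[|]]]]//; by case: w => [|[|[|[|]]]].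
Qed.

Let door (x y : nat) : nat := perm_eq [:: x; y] [:: 0; 1].

Let triangle_doors (s : seq nat) : size s = 3 -> all (fun x => x < 3) s ->
  odd (perm_eq s [:: 0; 1; 2]) =
  odd (if s is [:: x; y; z] then door y z + door x z + door x y else 0).
Proof.
case: s => [|x [|y [|z [|]]]]//= _.
case: x => [|[|[|]]]//; case: y => [|[|[|]]]//; by case: z => [|[|[|]]].
Qed.

Let path_doors n (p : nat -> nat) : (forall i, i <= n -> p i < 2) ->
  odd (\sum_(i <- iota 0 n) door (p i) (p i.+1)) = (p n != p 0).
Proof.
elim: n => [|n IH] pn; first by rewrite big_nil eqxx.
rewrite -addn1 iotaD big_cat /= big_seq1 add0n addn1 oddD IH; last first.
  by move=> i /leqW; exact: pn.
have := pn 0 isT; have := pn n (leqnSn _); have := pn n.+1 (leqnn _).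
rewrite /door.
case: (p n.+1) => [|[|]]//; case: (p n) => [|[|]]//; by case: (p 0) => [|[|]].
Qed.

Let path_no_door n (p : nat -> nat) a : (a < 2) -> (forall i, i <= n -> p i != a) ->
  \sum_(i <- iota 0 n) door (p i) (p i.+1) = 0.
Proof.
move=> a2 pa; rewrite big_seq big1// => i.
rewrite mem_iota add0n => /= lin; have pi := pa i (ltnW lin); have pi1 := pa i.+1 lin.
apply/eqP; rewrite eqb0; apply/negP => /perm_mem/(_ a).
rewrite !inE ![a == p _]eq_sym (negbTE pi) (negbTE pi1).
by case: a a2 {pa pi pi1} => [|[|]].
Qed.

Let sheet_doors n h : (forall j k, j <= n -> k <= n -> h j k < 3) ->
  odd (sheet (fun s => perm_eq s [:: 0; 1; 2] : nat) n h) =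
  odd (\sum_(k <- iota 0 n) door (h n k) (h n k.+1)
     + \sum_(k <- iota 0 n) door (h 0 k) (h 0 k.+1)
     + (\sum_(j <- iota 0 n) door (h j n) (h j.+1 n)
     + \sum_(j <- iota 0 n) door (h j 0) (h j.+1 0))).
Proof.
move=> h3; rewrite -sheet_boundary /sheet.
rewrite big_seq [in RHS]big_seq (big_morph odd oddD (erefl _)).
rewrite [RHS](big_morph odd oddD (erefl _)).
apply: eq_bigr => j; rewrite mem_iota add0n => /= jn.
rewrite big_seq [in RHS]big_seq (big_morph odd oddD (erefl _)).
rewrite [RHS](big_morph odd oddD (erefl _)).
apply: eq_bigr => k; rewrite mem_iota add0n => /= kn.
rewrite !big_cons !big_nil !addn0 !oddD.
have := h3 _ _ (ltnW jn) (ltnW kn); have := h3 _ _ jn (ltnW kn).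
have := h3 _ _ (ltnW jn) kn; have := h3 _ _ jn kn => h1 h2 h4 h5.
by congr (_ (+) _); (rewrite triangle_doors//=; [rewrite !oddD|apply/and4P]).
Qed.

(** A map of pairs from the cube to the tetrahedron, in combinatorial form: the
    label [c < 3] is excluded from the face [x_c = 0], and the label 3 from the
    three faces [x_c = n].  Rainbow tetrahedra have the parity of the triangles
    labelled 0, 1, 2 on the boundary.  These sit on the three faces [x_c = n],
    where their parity is that of the edges labelled 0, 1 along the borders of
    these faces.  The borders shared by two of the three faces cancel, and most
    others avoid one of the labels; what is left is a path on [z = 0] from a
    corner labelled 0 to a corner labelled 1. *)
Lemma sperner_cube n (l : nat -> nat -> nat -> nat) :
  (forall i j k, l i j k < 4) ->
  (forall i j, i <= n -> j <= n ->
    [/\ l 0 i j != 0, l i 0 j != 1 & l i j 0 != 2]) ->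
  (forall i j, i <= n -> j <= n ->
    [/\ l n i j != 3, l i n j != 3 & l i j n != 3]) ->
  odd (count (fun t => perm_eq t [:: 0; 1; 2; 3]) (kuhn n l)).
Proof.
move=> l4 lo hi.
rewrite -sum1_count big_mkcond /=.
rewrite (_ : odd _ = odd (\sum_(t <- kuhn n l) \sum_(s <- faces t)
    (perm_eq s [:: 0; 1; 2] : nat))); last first.
  rewrite big_seq [in RHS]big_seq (big_morph odd oddD (erefl _)).
  rewrite [RHS](big_morph odd oddD (erefl _)).
  apply: eq_bigr => t tk; rewrite rainbow_faces ?(size_kuhn tk)//.
    by case: ifP.
  case/allpairsPdep: tk => i [? [_ /allpairsPdep[j [? [_ /allpairsPdep[k [u [_ + ->]]] ->]]] ->]].
  by rewrite !inE; do 5?[case/orP => [/eqP ->|]]; rewrite /= ?l4//; move/eqP => ->; rewrite /= !l4.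
rewrite kuhn_boundary.
rewrite (@sheet_avoid _ [:: 0; 1; 2] n (fun j k => l 0 j k) 0)//;
  last by move=> j k jn kn; case: (lo j k jn kn).
rewrite (@sheet_avoid _ [:: 0; 1; 2] n (fun i k => l i 0 k) 1)//;
  last by move=> j k jn kn; case: (lo j k jn kn).
rewrite (@sheet_avoid _ [:: 0; 1; 2] n (fun i j => l i j 0) 2)//;
  last by move=> j k jn kn; case: (lo j k jn kn).
have lt3 m : m < 4 -> m != 3 -> m < 3 by case: m => [|[|[|[|]]]].
rewrite !addn0 !oddD.
rewrite (@sheet_doors n (fun j k => l n j k)); last first.
  by move=> j k jn kn; apply: lt3 => //; case: (hi j k jn kn).
rewrite (@sheet_doors n (fun j k => l j n k)); last first.
  by move=> j k jn kn; apply: lt3 => //; case: (hi j k jn kn).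
rewrite (@sheet_doors n (fun j k => l j k n)); last first.
  by move=> j k jn kn; apply: lt3 => //; case: (hi j k jn kn).
rewrite (@path_no_door n (fun k => l n 0 k) 1)//; last by move=> i lin; case: (lo n i).
rewrite (@path_no_door n (fun k => l 0 n k) 0)//; last by move=> i lin; case: (lo n i).
rewrite (@path_no_door n (fun k => l 0 k n) 0)//; last by move=> i lin; case: (lo i n).
rewrite (@path_no_door n (fun k => l k 0 n) 1)//; last by move=> i lin; case: (lo i n).
rewrite !oddD /=.
have lt2 m : m < 4 -> m != 3 -> m != 2 -> m < 2 by case: m => [|[|[|[|]]]].
rewrite (@path_doors n (fun j => l n j 0)); last first.
  by move=> i lin; apply: lt2 => //; [case: (hi i 0)|case: (lo n i)].
rewrite (@path_doors n (fun j => l j n 0)); last first.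
  by move=> i lin; apply: lt2 => //; [case: (hi i 0)|case: (lo i n)].
have [h1 h2 _] := hi 0 0 (leq0n n) (leq0n n).
have [h3 h4 h5] := lo n 0 (leqnn n) (leq0n n).
have [_ _ h6] := lo 0 n (leq0n n) (leqnn n).
have ln00 : l n 0 0 = 0.
  by move: (l4 n 0 0) h1 h4 h5; case: (l n 0 0) => [|[|[|[|]]]].
have l0n0 : l 0 n 0 = 1.
  by move: (l4 0 n 0) h2 h3 h6; case: (l 0 n 0) => [|[|[|[|]]]].
rewrite ln00 l0n0.
have : l n n 0 < 2.
  by apply: lt2 => //; [case: (hi n 0)|case: (lo n n)].
set a := odd (\sum_(k <- _) door (l n n k) _).
set b := odd (\sum_(k <- _) door (l n k n) _).
set c := odd (\sum_(k <- _) door (l k n n) _).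
by case: (l n n 0) => [|[|]]//; case: a; case: b; case: c.
Qed.

(** Group the rainbow tetrahedra of the domain by their images under the vertex
    map [g]: since they are odd in number, some group is odd. *)
Lemma odd_rainbow_class (X : eqType) n (g : nat -> nat -> nat -> X) (l : X -> nat) :
  odd (count (fun t => perm_eq t [:: 0; 1; 2; 3])
    (kuhn n (fun i j k => l (g i j k)))) ->
  exists t, [/\ t \in kuhn n g, perm_eq (map l t) [:: 0; 1; 2; 3] &
    odd (count (perm_eq t) (kuhn n g))].
Proof.
rewrite map_kuhn count_map => rb; apply: contrapT => nex; move: rb; apply/negP.
apply: (even_count_classes (e := perm_eq)).
- by move=> x y z; split => // /permPl ->.
- by move=> x y xy /=; rewrite (permPl (perm_map l xy)).
- by move=> t tk lt; apply/negP => ot; apply: nex; exists t.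
Qed.

End Sperner.

(** * The mod 2 degree over the lattice *)
Section Lattice.
Local Open Scope int_scope.

Definition lattice : Type := (int * int * int)%type.
Implicit Types v w : lattice.

(** Two vertices of a common simplex of the Freudenthal triangulation of
    space, whose simplices are the chains in the product order inside a unit
    cube. *)
Definition adjacent v w : bool :=
  [&& v.1.1 <= w.1.1 <= v.1.1 + 1, v.1.2 <= w.1.2 <= v.1.2 + 1
    & v.2 <= w.2 <= v.2 + 1] ||
  [&& w.1.1 <= v.1.1 <= w.1.1 + 1, w.1.2 <= v.1.2 <= w.1.2 + 1
    & w.2 <= v.2 <= w.2 + 1].

Definition on_boundary (n i j k : nat) : bool :=
  [&& (i <= n)%N, (j <= n)%N, (k <= n)%N &
   [|| i == 0%N, i == n, j == 0%N, j == n, k == 0%N | k == n]].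

Definition diag v : lattice := (v.1.1 + 1, v.1.2 + 1, v.2 + 1).

Variables (n : nat) (g : nat -> nat -> nat -> lattice).
Hypothesis g_adj : forall t, t \in kuhn n g ->
  {in t &, forall v w, adjacent v w}.

Definition off_boundary v : Prop :=
  forall i j k, on_boundary n i j k -> g i j k != v.

(** The degree modulo 2 of the simplicial map [g] over the tetrahedron [t]. *)
Definition local_degree (t : seq lattice) : bool :=
  odd (count (perm_eq t) (kuhn n g)).

Lemma local_degree_perm t u : perm_eq t u -> local_degree t = local_degree u.
Proof. by move=> /permPl tu; rewrite /local_degree (eq_count tu). Qed.

(** Each tetrahedron of the cube whose image contains the triangle [f] and is
    not degenerate maps onto [w1 :: f] or onto [w2 :: f].  No boundary triangle
    maps onto [f], so the faces mapped onto [f] pair up and the two degrees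
    agree. *)
Lemma local_degree_across (f : seq lattice) (c w1 w2 : lattice) : uniq f ->
  c \in f -> off_boundary c -> w1 != w2 -> w1 \notin f -> w2 \notin f ->
  (forall w, w \notin f -> {in f, forall v, adjacent w v} -> w = w1 \/ w = w2) ->
  local_degree (w1 :: f) = local_degree (w2 :: f).
Proof.
move=> uf cf cb w12 w1f w2f wf.
have := kuhn_boundary (fun s => perm_eq s f : nat) n g.
rewrite (@sheet_avoid _ f n (fun j k => g n j k) c)//; last first.
  by move=> j k jn kn; apply: cb; rewrite /on_boundary jn kn leqnn eqxx !orbT.
rewrite (@sheet_avoid _ f n (fun j k => g 0%N j k) c)//; last first.
  by move=> j k jn kn; apply: cb; rewrite /on_boundary jn kn eqxx.
rewrite (@sheet_avoid _ f n (fun j k => g j n k) c)//; last first.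
  by move=> j k jn kn; apply: cb; rewrite /on_boundary jn kn leqnn eqxx !orbT.
rewrite (@sheet_avoid _ f n (fun j k => g j 0%N k) c)//; last first.
  by move=> j k jn kn; apply: cb; rewrite /on_boundary jn kn eqxx !orbT.
rewrite (@sheet_avoid _ f n (fun j k => g j k n) c)//; last first.
  by move=> j k jn kn; apply: cb; rewrite /on_boundary jn kn leqnn eqxx !orbT.
rewrite (@sheet_avoid _ f n (fun j k => g j k 0%N) c)//; last first.
  by move=> j k jn kn; apply: cb; rewrite /on_boundary jn kn eqxx !orbT.
rewrite /=.
have ->: odd (\sum_(t <- kuhn n g) \sum_(s <- faces t) (perm_eq s f : nat)) =
  odd (\sum_(t <- kuhn n g) ((perm_eq (w1 :: f) t : nat) + (perm_eq (w2 :: f) t : nat))).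
  rewrite big_seq [in RHS]big_seq (big_morph odd oddD (erefl _)).
  rewrite [RHS](big_morph odd oddD (erefl _)); apply: eq_bigr => t tk.
  rewrite odd_faces_count ?(size_kuhn tk)// oddD !oddb.
  rewrite ![perm_eq (_ :: f) t]perm_sym.
  apply/hasP/idP => [[p pt /andP[pf ptf]]|].
    have mt := perm_mem ptf.
    have [|Ep|Ep] := wf p pf; rewrite ?Ep in ptf.
    - by move=> v vf; apply: (g_adj tk) => //; rewrite mt inE vf orbT.
    - rewrite (permPl ptf) perm_refl (permPl ptf) addTb.
      apply: contra w12 => /perm_mem/(_ w1); rewrite !inE eqxx (negbTE w1f).
      by rewrite !orbF => <-.
    - rewrite (permPl ptf) (permPl ptf) perm_refl addbT.
      apply: contra w12 => /perm_mem/(_ w2); rewrite !inE eqxx (negbTE w2f).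
      by rewrite !orbF eq_sym => <-.
  case p1 : (perm_eq t (w1 :: f)).
    by exists w1; rewrite ?w1f ?p1// (perm_mem p1) inE eqxx.
  case p2 : (perm_eq t (w2 :: f)) => // _.
  by exists w2; rewrite ?w2f ?p2// (perm_mem p2) inE eqxx.
rewrite big_split /= oddD.
have sum_count (P : pred (seq lattice)) r : (\sum_(t <- r) P t = count P r)%N.
  by elim: r => [|x r IH]; rewrite ?big_nil// big_cons IH.
by rewrite !sum_count /local_degree; do 2!case: (odd _).
Qed.

(** The triples [p] and [q] are meant to be the sums of the first one and the
    first two unit vectors, in some order; the list is then a simplex of the
    Freudenthal triangulation. *)
Definition tetra v (p q : int * int * int) : seq lattice :=
  [:: v; (v.1.1 + p.1.1, v.1.2 + p.1.2, v.2 + p.2);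
         (v.1.1 + q.1.1, v.1.2 + q.1.2, v.2 + q.2); diag v].

Lemma local_degree_replace (a b c w1 w2 : lattice) :
  [&& uniq [:: a; b; c], w1 != w2, w1 \notin [:: a; b; c] & w2 \notin [:: a; b; c]] ->
  off_boundary c ->
  (forall w, w \notin [:: a; b; c] ->
    adjacent w a -> adjacent w b -> adjacent w c -> w = w1 \/ w = w2) ->
  local_degree [:: w1; a; b; c] = local_degree [:: w2; a; b; c].
Proof.
move=> /and4P[ua w12 w1f w2f] cb wf.
apply: (local_degree_across (c := c)) => //; first by rewrite !inE eqxx !orbT.
by move=> w wN wadj; apply: wf => //; apply: wadj; rewrite !inE eqxx ?orbT.
Qed.

Lemma local_degree_rot1 a b c d : local_degree [:: a; b; c; d] = local_degree [:: b; a; c; d].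
Proof. by apply: local_degree_perm; rewrite (perm_catCA [:: a] [:: b]). Qed.

Lemma local_degree_rot2 a b c d : local_degree [:: a; b; c; d] = local_degree [:: c; a; b; d].
Proof. by apply: local_degree_perm; rewrite (perm_catCA [:: a; b] [:: c]). Qed.

Lemma local_degree_rot3 a b c d : local_degree [:: a; b; c; d] = local_degree [:: d; a; b; c].
Proof. by apply: local_degree_perm; rewrite (perm_catC [:: a; b; c] [:: d]). Qed.

Let eq_lattice_or (a b c x y z x' y' z' : int) :
  [|| [&& a == x, b == y & c == z] | [&& a == x', b == y' & c == z']] ->
  (a, b, c) = (x, y, z) \/ (a, b, c) = (x', y', z').
Proof. by case/orP => /and3P[/eqP-> /eqP-> /eqP->]; [left|right]. Qed.

Ltac replace_vertex cl :=
  apply: (local_degree_replace _ cl);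
  [by rewrite /= !inE !xpair_eqE /=; lia|];
  let v1 := fresh "v1" in let v2 := fresh "v2" in let v3 := fresh "v3" in
  move=> [[v1 v2] v3]; rewrite !inE !xpair_eqE /adjacent /= => *;
  apply: eq_lattice_or; lia.

(** All six tetrahedra of a cube share the corner [diag v], so crossing the
    six interior faces only requires that this corner is not a boundary
    value. *)
Lemma local_degree_cube v : off_boundary (diag v) ->
  [/\ local_degree (tetra v (1,0,0) (1,1,0)) = local_degree (tetra v (1,0,0) (1,0,1)),
      local_degree (tetra v (0,1,0) (1,1,0)) = local_degree (tetra v (0,1,0) (0,1,1))
    & local_degree (tetra v (0,0,1) (1,0,1)) = local_degree (tetra v (0,0,1) (0,1,1))] /\
  [/\ local_degree (tetra v (1,0,0) (1,1,0)) = local_degree (tetra v (0,1,0) (1,1,0)),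
      local_degree (tetra v (1,0,0) (1,0,1)) = local_degree (tetra v (0,0,1) (1,0,1))
    & local_degree (tetra v (0,1,0) (0,1,1)) = local_degree (tetra v (0,0,1) (0,1,1))].
Proof.
case: v => [[x y] z]; rewrite /tetra /diag /= => cl; split.
  by rewrite ![local_degree [:: (x, y, z); _; _; _]]local_degree_rot2; split;
    replace_vertex cl.
by rewrite ![local_degree [:: (x, y, z); _; _; _]]local_degree_rot1; split;
    replace_vertex cl.
Qed.

Definition shift v (d : int * int * int) : lattice :=
  (v.1.1 + d.1.1, v.1.2 + d.1.2, v.2 + d.2).

Lemma local_degree_next v : off_boundary (diag v) ->
  [/\ local_degree (tetra v (1,0,0) (1,1,0)) =
      local_degree (tetra (shift v (1,0,0)) (0,1,0) (0,1,1)),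
      local_degree (tetra v (0,1,0) (1,1,0)) =
      local_degree (tetra (shift v (0,1,0)) (1,0,0) (1,0,1))
    & local_degree (tetra v (0,0,1) (1,0,1)) =
      local_degree (tetra (shift v (0,0,1)) (1,0,0) (1,1,0))].
Proof.
case: v => [[x y] z]; rewrite /tetra /shift /diag /= !addr0 => cl.
by split; rewrite [RHS]local_degree_rot3; replace_vertex cl.
Qed.

(** The degree is thus a property of the cube.  It does not change when passing
    to a neighbouring cube. *)
Lemma local_degree_shift v d : d \in [:: (1,0,0); (0,1,0); (0,0,1)] ->
  off_boundary (diag v) -> off_boundary (diag (shift v d)) ->
  local_degree (tetra v (1,0,0) (1,1,0)) =
  local_degree (tetra (shift v d) (1,0,0) (1,1,0)).
Proof.
move=> dE /[dup] cv /local_degree_next[n1 n2 n3] /local_degree_cube[[a1 a2 a3] [b1 b2 b3]].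
have [[c1 c2 c3] [d1 d2 d3]] := local_degree_cube cv.
move: dE; rewrite !inE => /or3P[] /eqP dE; subst d.
- by rewrite n1 -a2 -b1.
- by rewrite d1 n2 -a1.
- by rewrite c1 d2 n3.
Qed.

(** Sorting four distinct, pairwise adjacent vertices by the sum of their
    coordinates gives a strictly increasing chain in a unit cube, hence a path
    of three unit steps. *)
Lemma tetraP (t : seq lattice) : size t = 4%N -> uniq t ->
  {in t &, forall v w, adjacent v w} ->
  exists v p q, perm_eq t (tetra v p q) /\
   (p, q) \in [:: ((1,0,0),(1,1,0)); ((1,0,0),(1,0,1)); ((0,1,0),(1,1,0));
                 ((0,1,0),(0,1,1)); ((0,0,1),(1,0,1)); ((0,0,1),(0,1,1))].
Proof.
pose s v : int := v.1.1 + v.1.2 + v.2.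
pose le v w := s v <= s w.
move=> st ut ta.
have := perm_sort le t; have : sorted le (sort le t).
  by apply: sort_sorted => v w; apply: le_total.
have := sort_uniq le t; have := size_sort le t; rewrite ut st.
case: (sort le t) => [|[[x y] z] [|[[x1 y1] z1] [|[[x2 y2] z2] [|[[x3 y3] z3] [|]]]]]//= _.
rewrite !inE !xpair_eqE /le /s /= => u so pt.
have tin v w : v \in [:: (x, y, z); (x1, y1, z1); (x2, y2, z2); (x3, y3, z3)] ->
  w \in [:: (x, y, z); (x1, y1, z1); (x2, y2, z2); (x3, y3, z3)] -> adjacent v w.
  by move=> vt wt; apply: ta; rewrite -(perm_mem (permEl pt)).
have mono (a b c a' b' c' : int) : adjacent (a, b, c) (a', b', c') ->
    a + b + c <= a' + b' + c' -> ~~ [&& a == a', b == b' & c == c'] ->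
    [/\ a <= a' <= a + 1, b <= b' <= b + 1, c <= c' <= c + 1
      & a + b + c + 1 <= a' + b' + c'].
  clear; rewrite /adjacent /= => /orP[]/and3P[A B C] S N.
    split => //; case/andP: A => A _; case/andP: B => B _; case/andP: C => C _.
    suff : a + b + c < a' + b' + c' by clear; lia.
    rewrite lt_neqAle S andbT; apply: contra N => /eqP E {S}.
    by apply/and3P; split; apply/eqP; clear -A B C E; lia.
  case/andP: A => A _; case/andP: B => B _; case/andP: C => C _; case/negP: N.
  by apply/and3P; split; apply/eqP; clear -A B C S; lia.
have [s1 s2 s3 _] := and4P so.
move: u; rewrite !negb_or -!andbA => /and5P[n1 n2 n3 n12 /and3P[n13 n23 _]].
have [|x1B y1B z1B S1] := mono _ _ _ _ _ _ _ s1 n1.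
  by apply: tin; rewrite !inE eqxx ?orbT.
have [|x2B y2B z2B S2] := mono _ _ _ _ _ _ _ s2 n12.
  by apply: tin; rewrite !inE eqxx ?orbT.
have [|x3B y3B z3B S3] := mono _ _ _ _ _ _ _ s3 n23.
  by apply: tin; rewrite !inE eqxx ?orbT.
have s03 : x + y + z <= x3 + y3 + z3 by apply: le_trans s1 _; apply: le_trans s2 _.
have [|x03 y03 z03 _] := mono _ _ _ _ _ _ _ s03 n3.
  by apply: tin; rewrite !inE eqxx ?orbT.
clear tin ta mono so s1 s2 s3 s03 n1 n2 n3 n12 n13 n23.
exists (x, y, z), (x1 - x, y1 - y, z1 - z), (x2 - x, y2 - y, z2 - z).
have ? : x3 = x + 1 by lia.
have ? : y3 = y + 1 by lia.
have ? : z3 = z + 1 by lia.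
subst x3 y3 z3; split.
  by rewrite -(permPl (permEl pt)) /tetra /diag /= ![_ + (_ - _)]addrC !subrK.
have T1 : x1 + y1 + z1 = x + y + z + 1 by clear -S1 S2 S3; lia.
have T2 : x2 + y2 + z2 = x + y + z + 2 by clear -S1 S2 S3; lia.
have X2 : x <= x2 <= x + 1 by clear -x1B x2B x3B; lia.
have Y2 : y <= y2 <= y + 1 by clear -y1B y2B y3B; lia.
have Z2 : z <= z2 <= z + 1 by clear -z1B z2B z3B; lia.
have bit (a b : int) : a <= b <= a + 1 -> b = a \/ b = a + 1 by clear; lia.
have sub1 (a : int) : a + 1 - a = 1 by clear; lia.
clear S1 S2 S3 pt x3B y3B z3B x03 y03 z03.
case: (bit _ _ x1B) => ?; case: (bit _ _ y1B) => ?; case: (bit _ _ z1B) => ?;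
  subst x1 y1 z1; try (by exfalso; clear -T1; lia); clear T1 x1B y1B z1B;
case: (bit _ _ X2) => ?; case: (bit _ _ Y2) => ?; case: (bit _ _ Z2) => ?;
  subst x2 y2 z2; try (by exfalso; clear -T2; lia); clear T2 X2 Y2 Z2;
  try (by exfalso; clear -x2B; lia);
  try (by exfalso; clear -y2B; lia);
  try (by exfalso; clear -z2B; lia);
by rewrite ?subrr ?sub1 !inE.
Qed.

Lemma rainbow_cube (l : lattice -> nat) :
  odd (count (fun t => perm_eq t [:: 0; 1; 2; 3]%N)
    (kuhn n (fun i j k => l (g i j k)))) ->
  exists t v, [/\ t \in kuhn n g, perm_eq (map l t) [:: 0; 1; 2; 3]%N,
    v \in t, diag v \in t &
    off_boundary (diag v) -> local_degree (tetra v (1,0,0) (1,1,0))].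
Proof.
move=> /odd_rainbow_class[t [tk lt dt]].
have ut : uniq t by apply: (@map_uniq _ _ l); rewrite (perm_uniq lt).
have [v [p [q [tE pq]]]] := tetraP (size_kuhn tk) ut (g_adj tk).
exists t, v; split => //; rewrite ?(perm_mem tE) ?inE ?eqxx ?orbT// => ob.
move: dt; rewrite -/(local_degree t) (local_degree_perm tE).
have [[a1 a2 a3] [b1 b2 b3]] := local_degree_cube ob.
move: pq {tE}; rewrite !inE => /or4P[|||/or3P[]] /eqP[-> ->] //.
- by rewrite -a1.
- by rewrite -b1.
- by rewrite -a2 -b1.
- by rewrite -b2 -a1.
- by rewrite -a3 -b2 -a1.
Qed.

End Lattice.

(** * Uniformity on compact sets *)
Section RowVectors.
Variables (R : realType) (n : nat).
Implicit Types x y : 'rV[R]_n.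

Lemma coord_le_norm x i : `|x ord0 i| <= `|x|.
Proof.
have /mapP[j Hj ->] : `|x ord0 i| \in [seq `|x z.1 z.2| | z : 'I_1 * 'I_n].
  by apply/mapP; exists (ord0, i) => //=; rewrite mem_enum.
by rewrite [leRHS]/Num.Def.normr /= mx_normrE; apply/bigmax_geP; right => /=; exists j.
Qed.

Lemma norm_le_coord x e : 0 <= e -> (forall i, `|x ord0 i| <= e) -> `|x| <= e.
Proof.
move=> e0 xe; rewrite [leLHS]/Num.Def.normr /= mx_normrE; apply/bigmax_leP; split => //.
by move=> [i j] _ /=; rewrite (ord1 i).
Qed.

End RowVectors.

Section CompactUniform.
Variables (R : realType) (E F : normedModType R).

Lemma within_continuousP (A : set E) (f : E -> F) :
  {within A, continuous f} <->
  forall x, A x -> forall e, 0 < e -> exists2 d, 0 < d &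
    forall y, A y -> `|x - y| < d -> `|f x - f y| < e.
Proof.
rewrite subspace_continuousP; split => cf x Ax.
  move=> e e0; have /cvgrPdist_lt/(_ _ e0) := cf x Ax.
  rewrite /within /= => /nbhs_ballP[d /= d0 dP]; exists d => // y Ay xy.
  by apply: dP => //; rewrite -ball_normE.
apply/cvgrPdist_lt => e e0; have [d d0 dP] := cf x Ax e e0.
rewrite /within /=; apply/nbhs_ballP; exists d => //= y; rewrite -ball_normE /=.
by move=> xy Ay; apply: dP.
Qed.

Lemma continuous_atP (f : E -> F) x : {for x, continuous f} <->
  forall e, 0 < e -> exists2 d, 0 < d &
    forall y, `|x - y| < d -> `|f x - f y| < e.
Proof.
split => [cf e e0|cf].
  have /cvgrPdist_lt/(_ _ e0) := cf.
  by move=> /nbhs_ballP[d /= d0 dP]; exists d => // y xy; apply: dP; rewrite -ball_normE.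
apply/cvgrPdist_lt => e e0; have [d d0 dP] := cf e e0.
apply/nbhs_ballP; exists d => //= y; rewrite -ball_normE /=.
by move=> xy; apply: dP.
Qed.

(** A scale that works locally works globally on a compact set. *)
Lemma compact_uniform (A : set E) (P : R -> E -> Prop) : compact A ->
  (forall d d' x, d' <= d -> P d x -> P d' x) ->
  (forall x, A x -> exists2 d, 0 < d & forall y, A y -> `|x - y| < d -> P d y) ->
  exists2 d, 0 < d & forall x, A x -> P d x.
Proof.
move=> /compact_near_coveringP cA Pmon loc.
have := cA R 0^'+ (fun d x => A x -> P d x) _.
case.
  move=> x /loc[d d0 dP]; exists (ball x d, [set e | e <= d]) => /=.
    by split; [exact: nbhsx_ballx|exact: nbhs_right_le].
  move=> [y e] /= [xy ed] Ay; apply: Pmon ed _; apply: dP => //.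
  by move: xy; rewrite -ball_normE.
move=> e /= e0 eP; exists (e / 2); first by rewrite divr_gt0.
move=> x Ax; apply: (eP (e / 2)) => //=.
  by rewrite sub0r normrN gtr0_norm ?divr_gt0// ltr_pdivrMr// ltr_pMr// ltr1n.
by rewrite divr_gt0.
Qed.

Lemma compact_uniform_continuous (A : set E) (f : E -> F) :
  compact A -> {within A, continuous f} -> forall e, 0 < e ->
  exists2 d, 0 < d & forall x y, A x -> A y -> `|x - y| < d -> `|f x - f y| < e.
Proof.
move=> cA /within_continuousP cf e e0.
pose P d x := forall y, A y -> `|x - y| < d -> `|f x - f y| < e.
have [|x Ax|d d0 dP] := @compact_uniform A P cA.
- by move=> d d' x d'd Px y Ay xy; apply: Px => //; apply: lt_le_trans d'd.
- have e20 : 0 < e / 2 by rewrite divr_gt0.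
  have [d d0 dP] := cf x Ax _ e20; exists (d / 2); first by rewrite divr_gt0.
  move=> x' Ax' xx' y Ay x'y; rewrite [e]splitr.
  rewrite -(subrKA (f x)) (le_lt_trans (ler_normD _ _))// ltrD//.
    rewrite distrC dP// (lt_trans xx')//.
    by rewrite ltr_pdivrMr// ltr_pMr// ltr1n.
  rewrite dP// -(subrKA x') (le_lt_trans (ler_normD _ _))//.
  by rewrite [d]splitr ltrD.
by exists d => // x y Ax; exact: dP.
Qed.

(** The inverse of an injective continuous map of a compact set is uniformly
    continuous. *)
Lemma compact_uniform_injective (A : set E) (f : E -> F) :
  compact A -> {within A, continuous f} -> {in A &, injective f} ->
  forall e, 0 < e -> exists2 d, 0 < d &
    forall x y, A x -> A y -> `|f x - f y| < d -> `|x - y| < e.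
Proof.
move=> cA cf injf e e0.
pose P d x := forall y, A y -> `|f x - f y| < d -> `|x - y| < e.
have [|x Ax|d d0 dP] := @compact_uniform A P cA.
- by move=> d d' x d'd Px y Ay xy; apply: Px => //; apply: lt_le_trans d'd.
- have e20 : 0 < e / 2 by rewrite divr_gt0.
  have [d d0 dP] : exists2 d, 0 < d &
      forall y, A y -> `|f x - f y| < d -> `|x - y| < e / 2.
    pose B := A `&` [set y | e / 2 <= `|x - y|].
    have [B0|/set0P B0] := eqVneq B set0.
      exists 1 => // y Ay _; rewrite ltNge; apply/negP => xy.
      by have : B y by []; rewrite B0.
    have cB : compact B.
      apply: compact_closedI => //.
      apply: (preimage_closed (f := fun y => `|x - y|) (D := [set r | e / 2 <= r]));
        last exact: closed_ge.
      move=> y _; apply: (@continuous_comp _ _ _ (fun y => x - y) Num.norm);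
        last exact: norm_continuous.
      by apply: cvgB; [exact: cvg_cst|exact: cvg_id].
    have [|y yB yP] := @compact_EVT_min E R (fun y => `|f x - f y|) B B0 cB.
      apply/subspace_continuousP => y [Ay _].
      have /subspace_continuousP/(_ y Ay) cfy := cf.
      apply: cvg_norm; apply: cvgB; first exact: cvg_cst.
      apply: cvg_trans cfy; apply: cvg_app; apply: within_subset; exact: subIsetl.
    move: yB; rewrite inE => -[Ay xy]; exists `|f x - f y|.
      rewrite normr_gt0 subr_eq0; apply/eqP => /injf fxy.
      by move: xy; rewrite fxy ?inE//= subrr normr0 leNgt e20.
    move=> z Az xz; rewrite ltNge; apply/negP => zx.
    by have := yP z; rewrite inE => /(_ (conj Az zx)); rewrite leNgt xz.
  have d20 : 0 < d / 2 by rewrite divr_gt0.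
  have /within_continuousP/(_ x Ax _ d20)[d' d'0 d'P] := cf.
  exists (Num.min (d / 2) (Num.min d' (e / 2))); first by rewrite !lt_min d20 d'0.
  move=> x' Ax'; rewrite !lt_min => /and3P[_ xx' xx'e] y Ay.
  rewrite !lt_min => /and3P[fx'y _ _].
  rewrite -(subrKA x) (le_lt_trans (ler_normD _ _))// [e]splitr ltrD//.
    by rewrite distrC.
  apply: dP => //; rewrite -(subrKA (f x')) (le_lt_trans (ler_normD _ _))//.
  by rewrite [d]splitr ltrD// d'P.
by exists d => // x y Ax; exact: dP.
Qed.

Lemma compact_nearest (A : set E) (f : E -> F) : A !=set0 ->
  compact A -> {within A, continuous f} -> forall p, exists2 x, A x &
  forall y, A y -> `|p - f x| <= `|p - f y|.
Proof.
move=> A0 cA cf p.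
have [|x xA xP] := @compact_EVT_min E R (fun y => `|p - f y|) A A0 cA.
  apply/subspace_continuousP => y Ay.
  have /subspace_continuousP/(_ y Ay) cfy := cf.
  by apply: cvg_norm; apply: cvgB; first exact: cvg_cst.
by exists x; [rewrite inE in xA|move=> y Ay; apply: xP; rewrite inE].
Qed.

End CompactUniform.

(** * Rounding to the lattice *)
Section Rounding.
Variable R : realType.
Implicit Types (a b c : R) (v w : lattice).

(** The numbers [0], [a], [b] and [c] lie in an interval of length 3/4. *)
Definition narrow a b c : Prop :=
  [/\ `|a| <= 3/4, `|b| <= 3/4 & `|c| <= 3/4] /\
  [/\ `|a - b| <= 3/4, `|a - c| <= 3/4 & `|b - c| <= 3/4].

(** Of the four quarters of the unit interval, one contains none of the three
    fractional parts.  Round down the coordinates whose fractional part lies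
    below this quarter and round up the others: all the errors then lie in an
    interval of length 3/4 around 0. *)
Lemma narrow_rounding a b c : exists v,
  narrow (a - v.1.1%:~R) (b - v.1.2%:~R) (c - v.2%:~R).
Proof.
pose t x : R := x - (Num.floor x)%:~R.
have t01 x : 0 <= t x < 1.
  by rewrite /t subr_ge0 ltrBlDl -[X in _ + X]/(1%:~R) -intrD floor_le floorD1_gt.
pose r (s : R) x : int := if t x < s then Num.floor x else Num.floor x + 1.
have r_spec (s x : R) : 0 <= s -> s + 1/4 <= 1 -> ~~ (s <= t x < s + 1/4) ->
    s + 1/4 - 1 <= x - (r s x)%:~R <= s.
  move=> s0 s1; rewrite /r negb_and -ltNge -leNgt.
  have /andP[tx0 tx1] := t01 x; move: tx0 tx1; rewrite /t => tx0 tx1.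
  case: ltP => [xs _|xs /= xs']; apply/andP; rewrite ?intrD; split; lra.
suff [s [s0 s1 sa sb sc]] : exists s : R, [/\ 0 <= s, s + 1/4 <= 1,
   ~~ (s <= t a < s + 1/4), ~~ (s <= t b < s + 1/4) & ~~ (s <= t c < s + 1/4)].
  exists (r s a, r s b, r s c); rewrite /narrow /=.
  have := r_spec s a s0 s1 sa; have := r_spec s b s0 s1 sb.
  have := r_spec s c s0 s1 sc => /andP[c1 c2] /andP[b1 b2] /andP[a1 a2].
  by split; split; rewrite ler_norml; apply/andP; split; lra.
have [s0|] := boolP [&& ~~ (0 <= t a < 0 + 1/4), ~~ (0 <= t b < 0 + 1/4) & ~~ (0 <= t c < 0 + 1/4)].
  by exists 0; case/and3P: s0 => ? ? ?; split => //; lra.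
have [s0|] := boolP [&& ~~ (1/4 <= t a < 1/4 + 1/4), ~~ (1/4 <= t b < 1/4 + 1/4)
  & ~~ (1/4 <= t c < 1/4 + 1/4)].
  by exists (1/4); case/and3P: s0 => ? ? ?; split => //; lra.
have [s0|] := boolP [&& ~~ (2/4 <= t a < 2/4 + 1/4), ~~ (2/4 <= t b < 2/4 + 1/4)
  & ~~ (2/4 <= t c < 2/4 + 1/4)].
  by exists (2/4); case/and3P: s0 => ? ? ?; split => //; lra.
have [s0|] := boolP [&& ~~ (3/4 <= t a < 3/4 + 1/4), ~~ (3/4 <= t b < 3/4 + 1/4)
  & ~~ (3/4 <= t c < 3/4 + 1/4)].
  by exists (3/4); case/and3P: s0 => ? ? ?; split => //; lra.
rewrite -!negb_or !negbK => /or3P h4 /or3P h3 /or3P h2 /or3P h1; exfalso.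
clear r r_spec t01.
by case: h1 => /andP[? ?]; case: h2 => /andP[? ?]; try lra;
   case: h3 => /andP[? ?]; try lra; case: h4 => /andP[? ?]; lra.
Qed.

Let lt2 (m : int) : `|m%:~R : R| < 2 -> -1 <= m <= 1.
Proof.
rewrite ltr_norml => /andP[m1 m2].
have : m < 2 by rewrite -(ltr_int R).
have : -2 < m by rewrite -(ltr_int R).
by clear; lia.
Qed.

(** Rounding each coordinate to the nearest integer would send close points to
    lattice points that differ by 1 in one coordinate and by -1 in another, and
    these are not adjacent.  The bound on differences of errors excludes
    this. *)
Lemma narrow_adjacent (p q : R * R * R) v w :
  narrow (p.1.1 - v.1.1%:~R) (p.1.2 - v.1.2%:~R) (p.2 - v.2%:~R) ->
  narrow (q.1.1 - w.1.1%:~R) (q.1.2 - w.1.2%:~R) (q.2 - w.2%:~R) ->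
  `|p.1.1 - q.1.1| < 1/8 -> `|p.1.2 - q.1.2| < 1/8 -> `|p.2 - q.2| < 1/8 ->
  adjacent v w.
Proof.
case: p q v w => [[a b] c] [[a' b'] c'] [[x y] z] [[x' y'] z'] /=.
move=> [[A B C] [AB AC BC]] [[A' B' C'] [AB' AC' BC']] da db dc.
have near1 (u u' : R) (m m' : int) : `|u - m%:~R| <= 3/4 -> `|u' - m'%:~R| <= 3/4 ->
    `|u - u'| < 1/8 -> -1 <= m' - m <= 1.
  rewrite !ler_norml ltr_norml => /andP[? ?] /andP[? ?] /andP[? ?].
  by apply: lt2; rewrite ltr_norml intrB; apply/andP; split; lra.
have near2 (u u' r r' : R) (m m' k k' : int) :
    `|(u - m%:~R) - (r - k%:~R)| <= 3/4 -> `|(u' - m'%:~R) - (r' - k'%:~R)| <= 3/4 ->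
    `|u - u'| < 1/8 -> `|r - r'| < 1/8 -> -1 <= (m' - m) - (k' - k) <= 1.
  rewrite !ler_norml !ltr_norml => /andP[? ?] /andP[? ?] /andP[? ?] /andP[? ?].
  by apply: lt2; rewrite ltr_norml !intrB; apply/andP; split; lra.
have hx := near1 _ _ _ _ A A' da; have hy := near1 _ _ _ _ B B' db.
have hz := near1 _ _ _ _ C C' dc.
have hxy := near2 _ _ _ _ _ _ _ _ AB AB' da db.
have hxz := near2 _ _ _ _ _ _ _ _ AC AC' da dc.
have hyz := near2 _ _ _ _ _ _ _ _ BC BC' db dc.
clear -hx hy hz hxy hxz hyz; rewrite /adjacent /=.
move: hx hy hz hxy hxz hyz => /andP[? ?] /andP[? ?] /andP[? ?] /andP[? ?] /andP[? ?] /andP[? ?].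
have [/or3P h|h] := boolP [|| x' < x, y' < y | z' < z]; apply/orP; [right|left].
  by case: h => h; apply/and3P; split; apply/andP; split; lia.
move: h; rewrite !negb_or -!leNgt => /and3P[? ? ?].
by apply/and3P; split; apply/andP; split; lia.
Qed.

End Rounding.

(** * Radial extension of a map of the sphere *)
Section Radial.
Variable R : realType.
Implicit Types x y : 'rV[R]_3.

Definition sqn n (x : 'rV[R]_n) : R := \sum_(i < n) x ord0 i ^+ 2.

Lemma sqn_ge0 n (x : 'rV[R]_n) : 0 <= sqn x.
Proof. by apply: sumr_ge0 => i _; exact: sqr_ge0. Qed.

Lemma sqr_coord_le_sqn n (x : 'rV[R]_n) i : x ord0 i ^+ 2 <= sqn x.
Proof.
by rewrite /sqn (bigD1 i)//= lerDl sumr_ge0// => j _; exact: sqr_ge0.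
Qed.

Lemma sqn_eq0 n (x : 'rV[R]_n) : (sqn x == 0) = (x == 0).
Proof.
apply/eqP/eqP => [x0|->]; last first.
  by rewrite /sqn big1// => i _; rewrite mxE expr0n.
apply/rowP => i; rewrite mxE; apply/eqP; rewrite -sqrf_eq0.
by rewrite eq_le sqr_ge0 andbT -x0 sqr_coord_le_sqn.
Qed.

Lemma sqn_gt0 n (x : 'rV[R]_n) : (0 < sqn x) = (x != 0).
Proof. by rewrite lt_def sqn_eq0 sqn_ge0 andbT. Qed.

Lemma sqnZ n a (x : 'rV[R]_n) : sqn (a *: x) = a ^+ 2 * sqn x.
Proof. by rewrite /sqn mulr_sumr; apply: eq_bigr => i _; rewrite mxE exprMn. Qed.

Lemma sqn_continuous n : continuous (@sqn n).
Proof.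
apply: (@continuous_big _ _ +%R) => [|i _ x]; first exact: add_continuous.
apply: (@continuous_comp _ _ _ (fun x : 'rV[R]_n => x ord0 i) (@GRing.exp R ^~ 2)).
  exact: coord_continuous.
exact: exprn_continuous.
Qed.

Lemma sqr_norm_le_sqn n (x : 'rV[R]_n) : `|x| ^+ 2 <= sqn x.
Proof.
rewrite -ler_sqrt ?sqn_ge0// sqrtr_sqr normr_id.
apply: norm_le_coord => [|i]; first exact: sqrtr_ge0.
by rewrite -sqrtr_sqr ler_sqrt ?sqn_ge0// sqr_coord_le_sqn.
Qed.

Lemma sqn_le_norm n (x : 'rV[R]_n) : sqn x <= n%:R * `|x| ^+ 2.
Proof.
rewrite /sqn; apply: (@le_trans _ _ (\sum_(i < n) `|x| ^+ 2)).
  apply: ler_sum => i _; rewrite -[leLHS]real_normK ?num_real//.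
  by rewrite lerXn2r ?nnegrE// coord_le_norm.
by rewrite sumr_const card_ord mulr_natl.
Qed.

Lemma eucl_distE n (x y : 'rV[R]_n) : eucl_dist x y = Num.sqrt (sqn (x - y)).
Proof. by rewrite /eucl_dist /sqn; congr Num.sqrt; apply: eq_bigr => i _; rewrite !mxE. Qed.

Lemma sphere2P x : sphere2 R x <-> sqn x = 1.
Proof.
rewrite /sphere2 /= eucl_distE subr0; split => [x1|->]; last by rewrite sqrtr1.
by rewrite -(sqr_sqrtr (sqn_ge0 x)) x1 expr1n.
Qed.

Lemma bounded_normP n (A : set 'rV[R]_n) M :
  (forall z, A z -> `|z| <= M) -> bounded_set A.
Proof. by move=> AM; exists M; split; [exact: num_real|move=> M' /ltW MM' x /AM /le_trans]; apply. Qed.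

Lemma sphere2_compact : compact (sphere2 R).
Proof.
apply: bounded_closed_compact.
  apply: (@bounded_normP _ _ 1) => x /sphere2P x1.
  by rewrite -(expr_le1 (n := 2))// -x1 sqr_norm_le_sqn.
rewrite (_ : sphere2 R = sqn (n := 3) @^-1` [set 1]); last first.
  by apply/seteqP; split => x /sphere2P.
apply: preimage_closed; last exact: closed_eq.
by move=> x _; exact: sqn_continuous.
Qed.

Lemma sphere2_nonempty : sphere2 R !=set0.
Proof.
exists (delta_mx ord0 ord0); apply/sphere2P; rewrite /sqn (bigD1 ord0)//=.
rewrite mxE !eqxx expr1n big1 ?addr0// => i i0.
by rewrite mxE (negbTE i0) andbF expr0n.
Qed.

(** Radial projection; it identifies the surface of the cube, which is the unit
    sphere of the maximum norm, with the round sphere. *)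
Definition direction x : 'rV[R]_3 := (Num.sqrt (sqn x))^-1 *: x.

Lemma sphere2_direction x : x != 0 -> sphere2 R (direction x).
Proof.
move=> x0; apply/sphere2P; rewrite sqnZ exprVn sqr_sqrtr ?sqn_ge0//.
by rewrite mulVf// sqn_eq0.
Qed.

Lemma direction_continuous x : x != 0 -> {for x, continuous direction}.
Proof.
move=> x0; apply: (@cvgZ _ _ _ (nbhs x) _ (fun y => (Num.sqrt (sqn y))^-1) id).
  apply: (@cvgV _ _ (nbhs x) _ (fun y => Num.sqrt (sqn y))).
    by rewrite sqrtr_eq0 -ltNge sqn_gt0.
  apply: (@continuous_comp _ _ _ (@sqn 3) Num.sqrt).
    exact: sqn_continuous.
  exact: sqrt_continuous.
exact: cvg_id.
Qed.

(** The constant 1/2 comes from the length of a vector of maximum norm 1, which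
    is at most the square root of 3, hence less than 2. *)
Lemma direction_coord x i : `|x| = 1 -> x ord0 i ^+ 2 = 1 -> 
  1/2 <= `|direction x ord0 i| /\ (0 < direction x ord0 i) = (0 < x ord0 i).
Proof.
move=> x1 xi.
have s0 : 0 < sqn x by rewrite sqn_gt0 -normr_gt0 x1.
have s2 : Num.sqrt (sqn x) <= 2.
  rewrite -[leRHS]ger0_norm// -sqrtr_sqr ler_sqrt ?sqr_ge0//.
  by rewrite (le_trans (sqn_le_norm _))// x1 expr1n; lra.
have sq0 : 0 < Num.sqrt (sqn x) by rewrite sqrtr_gt0.
rewrite mxE; split; last by rewrite pmulr_rgt0 ?invr_gt0.
have -> : `|(Num.sqrt (sqn x))^-1 * x ord0 i| = (Num.sqrt (sqn x))^-1.
  rewrite normrM gtr0_norm ?invr_gt0// (_ : `|x ord0 i| = 1) ?mulr1//.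
  by apply/eqP; rewrite -(@eqrXn2 _ 2)// real_normK ?num_real// xi expr1n.
by rewrite div1r lef_pV2// posrE.
Qed.

Variable f : 'rV[R]_3 -> 'rV[R]_3.
Hypothesis fcont : {within sphere2 R, continuous f}.

Definition radial x : 'rV[R]_3 := `|x| *: f (direction x).

Lemma sphere2_image_bounded : exists2 M, 0 < M & forall u, sphere2 R u -> `|f u| <= M.
Proof.
have /ex_strict_bound_gt0[M M0 MP] : bounded_set (f @` sphere2 R).
  by apply/compact_bounded/continuous_compact => //; exact: sphere2_compact.
by exists M => // u Su; apply/ltW/MP; exists u.
Qed.

Lemma radial_continuous : continuous radial.
Proof.
have [M M0 fM] := sphere2_image_bounded.
move=> x; have [->|x0] := eqVneq x 0.
  apply/continuous_atP => e e0; rewrite /radial normr0 scale0r.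
  exists (e / M); rewrite ?divr_gt0// => y.
  rewrite !sub0r !normrN normrZ normr_id => yM.
  have [->|y0] := eqVneq y 0; first by rewrite normr0 mul0r.
  rewrite (le_lt_trans (ler_wpM2l _ (fM _ (sphere2_direction y0))))//.
  by rewrite -ltr_pdivlMr.
apply: (@cvgZ _ _ _ (nbhs x) _ Num.norm (f \o direction)).
  exact: norm_continuous.
suff : {for x, continuous (f \o direction)} by [].
apply/continuous_atP => e e0.
have Sx := sphere2_direction x0.
have /within_continuousP/(_ _ Sx e e0)[d d0 dP] := fcont.
have /continuous_atP/(_ d d0)[d' d'0 d'P] := direction_continuous x0.
exists (Num.min d' `|x|) => [|y]; first by rewrite lt_min d'0 normr_gt0.
rewrite lt_min => /andP[xy xy']; apply: dP; last exact: d'P.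
apply: sphere2_direction; apply: contraTneq xy' => ->.
by rewrite subr0 ltxx.
Qed.

Lemma radial_boundary x : `|x| = 1 -> radial x = f (direction x).
Proof. by move=> x1; rewrite /radial x1 scale1r. Qed.

End Radial.

(** * Simplicial approximation *)
Section Grid.
Variable R : realType.

Definition o0 : 'I_3 := ord0.
Definition o1 : 'I_3 := @Ordinal 3 1 isT.
Definition o2 : 'I_3 := @Ordinal 3 2 isT.

Lemma ord3_ind (P : 'I_3 -> Prop) : P o0 -> P o1 -> P o2 -> forall i, P i.
Proof.
move=> P0 P1 P2 [[|[|[|//]]] h].
- by rewrite (_ : Ordinal h = o0)//; exact: val_inj.
- by rewrite (_ : Ordinal h = o1)//; exact: val_inj.
- by rewrite (_ : Ordinal h = o2)//; exact: val_inj.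
Qed.

Definition row3 (a b c : R) : 'rV[R]_3 :=
  \row_(i < 3) match val i with 0%N => a | 1%N => b | _ => c end.

Lemma row3E a b c : [/\ row3 a b c ord0 o0 = a, row3 a b c ord0 o1 = b
  & row3 a b c ord0 o2 = c].
Proof. by split; rewrite mxE. Qed.

Lemma norm_row3 a b c e : 0 <= e -> `|a| <= e -> `|b| <= e -> `|c| <= e ->
  `|row3 a b c| <= e.
Proof.
by move=> e0 ae be ce; apply: norm_le_coord => //; apply: ord3_ind; rewrite mxE.
Qed.

Definition point (v : lattice) : 'rV[R]_3 := row3 v.1.1%:~R v.1.2%:~R v.2%:~R.

Definition grid_point (n i j k : nat) : 'rV[R]_3 :=
  row3 (2 * i%:R / n%:R - 1) (2 * j%:R / n%:R - 1) (2 * k%:R / n%:R - 1).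

Let grid_coord (n i : nat) : (0 < n)%N -> (i <= n)%N ->
  `|2 * i%:R / n%:R - 1 : R| <= 1.
Proof.
move=> n0 lin; have n0' : 0 < n%:R :> R by rewrite ltr0n.
rewrite ler_norml lerBrDl addrN lerBlDr; apply/andP; split.
  by rewrite divr_ge0// mulr_ge0.
by rewrite ler_pdivrMr// ler_wpM2l// ler_nat.
Qed.

Lemma grid_point_le1 n i j k : (0 < n)%N -> (i <= n)%N -> (j <= n)%N ->
  (k <= n)%N -> `|grid_point n i j k| <= 1.
Proof. by move=> n0 lin ljn lkn; apply: norm_row3 => //; exact: grid_coord. Qed.

Let face0 n : 2 * 0%:R / n%:R - 1 = -1 :> R.
Proof. by rewrite mulr0 mul0r sub0r. Qed.

Let facen n : (0 < n)%N -> 2 * n%:R / n%:R - 1 = 1 :> R.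
Proof. by move=> n0; rewrite mulfK ?pnatr_eq0 -?lt0n//; lra. Qed.

Lemma grid_point_boundary n i j k : (0 < n)%N -> on_boundary n i j k ->
  `|grid_point n i j k| = 1.
Proof.
move=> n0 /and4P[lin ljn lkn bd]; apply/eqP; rewrite eq_le grid_point_le1//=.
have [e0 e1 e2] := row3E (2 * i%:R / n%:R - 1) (2 * j%:R / n%:R - 1) (2 * k%:R / n%:R - 1).
case/or4P: bd => [|||/or3P[]] /eqP E; subst.
- by rewrite (le_trans _ (coord_le_norm _ o0))// e0 face0 normrN1.
- by rewrite (le_trans _ (coord_le_norm _ o0))// e0 facen// normr1.
- by rewrite (le_trans _ (coord_le_norm _ o1))// e1 face0 normrN1.
- by rewrite (le_trans _ (coord_le_norm _ o1))// e1 facen// normr1.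
- by rewrite (le_trans _ (coord_le_norm _ o2))// e2 face0 normrN1.
- by rewrite (le_trans _ (coord_le_norm _ o2))// e2 facen// normr1.
Qed.

(** The boundary condition of Sperner's lemma, with a margin 1/2 that survives
    the replacement of [u] by a nearby point of the sphere. *)
Definition on_faces (n i j k : nat) (u : 'rV[R]_3) : Prop :=
  [/\ i = 0%N -> u ord0 o0 <= - (1/2), j = 0%N -> u ord0 o1 <= - (1/2) &
      k = 0%N -> u ord0 o2 <= - (1/2)] /\
  [/\ i = n -> 1/2 <= u ord0 o0, j = n -> 1/2 <= u ord0 o1 &
      k = n -> 1/2 <= u ord0 o2].

Let direction_lo (x : 'rV[R]_3) i : `|x| = 1 -> x ord0 i = -1 ->
  direction x ord0 i <= - (1/2) :> R.
Proof.
move=> x1 xi; have [|h1 h2] := @direction_coord R x i x1; first by rewrite xi sqrrN expr1n.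
have : direction x ord0 i <= 0 by rewrite leNgt h2 xi -leNgt; lra.
by move=> d0; move: h1; rewrite ler0_norm//; lra.
Qed.

Let direction_hi (x : 'rV[R]_3) i : `|x| = 1 -> x ord0 i = 1 ->
  1/2 <= direction x ord0 i :> R.
Proof.
move=> x1 xi; have [|h1 h2] := @direction_coord R x i x1; first by rewrite xi expr1n.
have : 0 < direction x ord0 i by rewrite h2 xi.
by move=> d0; move: h1; rewrite gtr0_norm.
Qed.

Lemma on_faces_direction n i j k : (0 < n)%N -> on_boundary n i j k ->
  on_faces n i j k (direction (grid_point n i j k)).
Proof.
move=> n0 bd; have g1 := grid_point_boundary n0 bd.
have [e0 e1 e2] := row3E (2 * i%:R / n%:R - 1) (2 * j%:R / n%:R - 1) (2 * k%:R / n%:R - 1).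
split; split=> E.
- by apply: direction_lo => //; rewrite e0 E face0.
- by apply: direction_lo => //; rewrite e1 E face0.
- by apply: direction_lo => //; rewrite e2 E face0.
- by apply: direction_hi => //; rewrite e0 E facen.
- by apply: direction_hi => //; rewrite e1 E facen.
- by apply: direction_hi => //; rewrite e2 E facen.
Qed.

Lemma grid_point_close n i j k (a b c a' b' c' : bool) : (0 < n)%N ->
  `|grid_point n (i + a) (j + b) (k + c) -
    grid_point n (i + a') (j + b') (k + c')| <= 2 / n%:R.
Proof.
move=> n0; have n0' : 0 < n%:R :> R by rewrite ltr0n.
have cl (m : nat) (d d' : bool) :
    `|2 * (m + d)%:R / n%:R - 1 - (2 * (m + d')%:R / n%:R - 1) : R| <= 2 / n%:R.
  rewrite (_ : _ - _ = (2 / n%:R) * (d%:R - d'%:R)); last by rewrite !natrD; ring.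
  rewrite normrM gtr0_norm ?divr_gt0// ler_piMr ?divr_ge0//.
  by case: d; case: d'; rewrite /= ?subrr ?normr0 ?subr0 ?sub0r ?normrN ?normr1.
apply: norm_le_coord; first by rewrite divr_ge0.
by apply: ord3_ind; rewrite !mxE /=.
Qed.

Variable f : 'rV[R]_3 -> 'rV[R]_3.
Hypothesis fcont : {within sphere2 R, continuous f}.

(** A simplicial approximation of the radial extension of [f], from a Kuhn
    triangulation of the cube, subdivided finely enough, to the lattice of mesh
    [1 / K].  On the surface of the cube it stays within [1 / K] of [f]. *)
Lemma grid_map (M : R) (K : nat) : (forall u, sphere2 R u -> `|f u| <= M) ->
  (0 < K)%N ->
  exists n (g : nat -> nat -> nat -> lattice) (u : nat -> nat -> nat -> 'rV[R]_3),
  [/\ (0 < n)%N,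
    forall t, t \in kuhn n g -> {in t &, forall v w, adjacent v w},
    forall i j k, (i <= n)%N -> (j <= n)%N -> (k <= n)%N ->
      `|K%:R^-1 *: point (g i j k)| <= M + 1 &
    forall i j k, on_boundary n i j k -> [/\ sphere2 R (u i j k),
      `|K%:R^-1 *: point (g i j k) - f (u i j k)| <= K%:R^-1 &
      on_faces n i j k (u i j k)]].
Proof.
move=> fM K0; have K0' : 0 < K%:R :> R by rewrite ltr0n.
have K1' : K%:R^-1 <= 1 :> R by rewrite invf_le1// ler1n.
pose B := [set x : 'rV[R]_3 | `|x| <= 1].
have cB : compact B.
  apply: bounded_closed_compact; first exact: (@bounded_normP _ _ _ 1).
  apply: (preimage_closed (f := fun x : 'rV[R]_3 => `|x|) (D := [set r : R | r <= 1]));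
    last exact: closed_le.
  by move=> x _; exact: norm_continuous.
have e0 : 0 < K%:R^-1 / 8 :> R by rewrite divr_gt0// invr_gt0.
have [d d0 dP] : exists2 d, 0 < d & forall x y, B x -> B y -> `|x - y| < d ->
    `|radial f x - radial f y| < K%:R^-1 / 8.
  apply: compact_uniform_continuous => //.
  exact/continuous_subspaceT/radial_continuous.
pose n := Num.bound (2 / d).
have n0' : 2 / d < n%:R by rewrite archi_boundP// ltW// divr_gt0.
have n0 : (0 < n)%N by rewrite -(ltr_nat R) (le_lt_trans _ n0')// ltW// divr_gt0.
have nd : 2 / n%:R < d.
  by rewrite ltr_pdivrMr ?ltr0n// -ltr_pdivrMl// mulrC.
have [r rP] := @choice 'rV[R]_3 lattice (fun p v => narrow (p ord0 o0 - v.1.1%:~R)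
  (p ord0 o1 - v.1.2%:~R) (p ord0 o2 - v.2%:~R)) (fun p => narrow_rounding _ _ _).
pose G i j k := radial f (grid_point n i j k).
have GP i j k : `|K%:R^-1 *: point (r (K%:R *: G i j k)) - G i j k| <= K%:R^-1.
  rewrite -[X in _ - X]scale1r -[X in _ - X *: _](mulVf (lt0r_neq0 K0')) -scalerA -scalerBr.
  rewrite normrZ gtr0_norm ?invr_gt0// ler_piMr ?invr_ge0 ?ler0n//.
  have [[h0 h1 h2] _] := rP (K%:R *: G i j k).
  have [p0 p1 p2] := row3E (r (K%:R *: G i j k)).1.1%:~R (r (K%:R *: G i j k)).1.2%:~R (r (K%:R *: G i j k)).2%:~R.
  have le1 (z : R) : `|z| <= 3/4 -> `|z| <= 1 by move=> h; lra.
  rewrite distrC; apply: norm_le_coord => //; apply: ord3_ind.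
  - by rewrite mxE [X in _ + X]mxE p0 le1.
  - by rewrite mxE [X in _ + X]mxE p1 le1.
  - by rewrite mxE [X in _ + X]mxE p2 le1.
exists n, (fun i j k => r (K%:R *: G i j k)), (fun i j k => direction (grid_point n i j k)).
split => //.
- move=> t /mem_kuhn[i [j [k [lin ljn lkn tP]]]] v w /tP[a [b [c ->]]] /tP[a' [b' [c' ->]]].
  pose p := K%:R *: G (i + a)%N (j + b)%N (k + c)%N.
  pose q := K%:R *: G (i + a')%N (j + b')%N (k + c')%N.
  have pq l : `|p ord0 l - q ord0 l| < 1/8.
    rewrite (_ : _ - _ = (p - q) ord0 l); last by rewrite [RHS]mxE [X in _ = _ + X]mxE.
    apply: le_lt_trans (coord_le_norm _ _) _.
    rewrite -scalerBr normrZ gtr0_norm// -ltr_pdivlMl// mul1r.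
    have ble (m : nat) (b0 : bool) : (m < n)%N -> (m + b0 <= n)%N.
      by move=> mn; case: b0; rewrite ?addn1// addn0 ltnW.
    apply: dP; rewrite /B /= ?grid_point_le1 ?ble//.
    by apply: le_lt_trans nd; exact: grid_point_close.
  exact: (narrow_adjacent (p := (p ord0 o0, p ord0 o1, p ord0 o2))
    (q := (q ord0 o0, q ord0 o1, q ord0 o2)) (rP p) (rP q) (pq o0) (pq o1) (pq o2)).
- move=> i j k lin ljn lkn; rewrite -[X in `|X|](subrK (G i j k)).
  rewrite (le_trans (ler_normD _ _))// addrC lerD//; last exact: le_trans (GP _ _ _) _.
  rewrite /G /radial; set x := grid_point _ _ _ _.
  have x1 : `|x| <= 1 by exact: grid_point_le1.
  have M0 : 0 <= M.
    by have [u Su] := sphere2_nonempty R; rewrite (le_trans _ (fM u Su)).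
  rewrite normrZ normr_id; have [->|x0] := eqVneq x 0; first by rewrite normr0 mul0r.
  rewrite -[leRHS]mul1r ler_pM// fM//; exact: sphere2_direction.
- move=> i j k bd; have x1 := grid_point_boundary n0 bd.
  have x0 : grid_point n i j k != 0 by rewrite -normr_gt0 x1.
  split; [exact: sphere2_direction| |exact: on_faces_direction].
  by rewrite -(radial_boundary f x1); exact: GP.
Qed.

End Grid.

(** * An embedded sphere bounds a region *)
Lemma int_path (P : int -> Prop) (h : int -> bool) (a b : int) :
  (forall x, (a <= x <= b) || (b <= x <= a) -> P x) ->
  (forall x, P x -> P (x + 1) -> h x = h (x + 1)) -> h a = h b.
Proof.
wlog ab : a b / a <= b => [hw Pab hP|].
  have [ab|ba] := leP a b; first exact: hw.
  apply/esym/hw => //; first exact: ltW.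
  by move=> x xab; apply: Pab; rewrite orbC.
have [m ->] : exists m : nat, b = a + m%:Z by exists `|b - a|%N; lia.
elim: m {ab b} => [|m IH] Pab hP; first by rewrite addr0.
rewrite IH => [|x xm|//]; last by apply: Pab; lia.
have -> : a + m.+1%:Z = a + m%:Z + 1 by clear; lia.
by apply: hP; apply: Pab; clear; lia.
Qed.

Lemma local_degree_path n (g : nat -> nat -> nat -> lattice) (v w : lattice) :
  (forall t, t \in kuhn n g -> {in t &, forall v w, adjacent v w}) ->
  (forall x : lattice,
    (v.1.1 <= x.1.1 <= w.1.1) || (w.1.1 <= x.1.1 <= v.1.1) ->
    (v.1.2 <= x.1.2 <= w.1.2) || (w.1.2 <= x.1.2 <= v.1.2) ->
    (v.2 <= x.2 <= w.2) || (w.2 <= x.2 <= v.2) -> off_boundary n g (diag x)) ->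
  local_degree n g (tetra v (1,0,0) (1,1,0)) =
  local_degree n g (tetra w (1,0,0) (1,1,0)).
Proof.
case: v w => [[a b] c] [[a' b'] c'] /= gadj off.
pose D x y z := local_degree n g (tetra (x, y, z) (1,0,0) (1,1,0)).
have ends (k l : int) : (k <= k <= l) || (l <= k <= k) by rewrite lexx; lia.
have ends' (k l : int) : (k <= l <= l) || (l <= l <= k) by rewrite lexx; lia.
apply: (@etrans _ _ (D a' b c)).
  apply: (@int_path (fun x => off_boundary n g (diag (x, b, c))) (fun x => D x b c)).
    by move=> x xa; apply: off.
  move=> x ox ox1; rewrite /D (local_degree_shift gadj (d := (1,0,0)))// /shift /= ?addr0//.
apply: (@etrans _ _ (D a' b' c)).
  apply: (@int_path (fun x => off_boundary n g (diag (a', x, c))) (fun x => D a' x c)).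
    by move=> x xa; apply: off.
  move=> x ox ox1; rewrite /D (local_degree_shift gadj (d := (0,1,0)))// /shift /= ?addr0//.
apply: (@int_path (fun x => off_boundary n g (diag (a', b', x))) (fun x => D a' b' x)).
  by move=> x xa; apply: off.
by move=> x ox ox1; rewrite /D (local_degree_shift gadj (d := (0,0,1)))// /shift /= ?addr0//.
Qed.

Section Region.
Variable R : realType.

Lemma between_floors (k a b e : R) (x : int) : 0 < k -> `|a - b| <= e ->
  (Num.floor (k * a) <= x <= Num.floor (k * b)) ||
  (Num.floor (k * b) <= x <= Num.floor (k * a)) ->
  `|k^-1 * (x + 1)%:~R - a| <= e + k^-1.
Proof.
move=> k0 abe xab.
have fl (c : R) : Num.floor (k * c) <= x -> c <= k^-1 * (x + 1)%:~R.
  move=> cx; rewrite ler_pdivlMl//; apply/ltW/(lt_le_trans (floorD1_gt _)).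
  by rewrite ler_int lerD2r.
have fu (c : R) : x <= Num.floor (k * c) -> k^-1 * (x + 1)%:~R <= c + k^-1.
  move=> cx; rewrite ler_pdivrMl// mulrDr mulfV ?gt_eqF// intrD lerD2r.
  by rewrite (le_trans _ (floor_le _))// ler_int.
have k10 : 0 < k^-1 by rewrite invr_gt0.
move: abe; rewrite !ler_norml => /andP[? ?].
by case/orP: xab => /andP[/fl ? /fu ?]; apply/andP; split; lra.
Qed.

(** A coarse labelling of directions which, near the faces of the cube, obeys
    the boundary condition of Sperner's lemma. *)
Definition orthant (u : 'rV[R]_3) : nat :=
  if 0 <= u ord0 o0 then 0%N else if 0 <= u ord0 o1 then 1%N
  else if 0 <= u ord0 o2 then 2%N else 3%N.

Lemma orthant_lt4 u : (orthant u < 4)%N.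
Proof. by rewrite /orthant; case: ifP => // _; case: ifP => // _; case: ifP. Qed.

(** Near a point of the sphere at most three labels occur: four close points
    with four labels would all have every coordinate close to 0. *)
Lemma orthant_far (u : nat -> 'rV[R]_3) :
  (forall i, sphere2 R (u i)) ->
  (forall i j, (i < 4)%N -> (j < 4)%N -> `|u i - u j| < 1/10) ->
  ~ (forall i, (i < 4)%N -> orthant (u i) = i).
Proof.
move=> Su uij uE.
have cl i j l : (i < 4)%N -> (j < 4)%N -> u i ord0 l - u j ord0 l < 1/10.
  move=> i4 j4; apply: le_lt_trans (uij i j i4 j4).
  rewrite (_ : _ - _ = (u i - u j) ord0 l); last first.
    by rewrite [RHS]mxE [X in _ = _ + X]mxE.
  exact: le_trans (ler_norm _) (coord_le_norm _ l).
have h0 v : orthant v = 0%N -> 0 <= v ord0 o0.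
  by rewrite /orthant; case: ifP => // _; case: ifP => // _; case: ifP.
have h1 v : orthant v = 1%N -> 0 <= v ord0 o1.
  by rewrite /orthant; case: ifP => // _; case: ifP => // _; case: ifP.
have h2 v : orthant v = 2%N -> 0 <= v ord0 o2.
  by rewrite /orthant; case: ifP => // _; case: ifP => // _; case: ifP.
have h3 v : orthant v = 3%N -> [/\ v ord0 o0 < 0, v ord0 o1 < 0 & v ord0 o2 < 0].
  rewrite /orthant; case: lerP => // ? ; case: lerP => // ?.
  by case: lerP => // ? _; split.
have b0 := h0 _ (uE 0%N isT); have b1 := h1 _ (uE 1%N isT).
have b2 := h2 _ (uE 2%N isT); have [a0 a1 a2] := h3 _ (uE 3%N isT).
have /sphere2P := Su 3%N; rewrite /sqn !big_ord_recl big_ord0.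
rewrite (_ : lift ord0 ord0 = o1); last exact: val_inj.
rewrite (_ : lift ord0 _ = o2); last exact: val_inj.
rewrite -/o0.
have := cl 0%N 3%N o0 isT isT; have := cl 1%N 3%N o1 isT isT.
have := cl 2%N 3%N o2 isT isT => c2 c1 c0.
nra.
Qed.

Lemma point_adjacent (v w : lattice) : adjacent v w ->
  `|point R v - point R w| <= 1.
Proof.
case: v w => [[a b] c] [[a' b'] c'] vw.
have le1 (x y : int) : (x <= y <= x + 1) || (y <= x <= y + 1) -> `|x%:~R - y%:~R : R| <= 1.
  move=> xy; rewrite -intrB -intr_norm -[leRHS]/(1%:~R) ler_int ler_norml.
  by case/orP: xy => /andP[? ?]; apply/andP; split; lia.
have [A B C] : [/\ (a <= a' <= a + 1) || (a' <= a <= a' + 1),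
    (b <= b' <= b + 1) || (b' <= b <= b' + 1) &
    (c <= c' <= c + 1) || (c' <= c <= c' + 1)].
  by case/orP: vw => /and3P[-> -> ->]; rewrite ?orbT.
apply: norm_le_coord => //; have [p0 p1 p2] := row3E (a%:~R : R) b%:~R c%:~R.
have [p0' p1' p2'] := row3E (a'%:~R : R) b'%:~R c'%:~R.
by apply: ord3_ind; rewrite mxE [X in _ + X]mxE /point /= ?p0 ?p1 ?p2 ?p0' ?p1' ?p2' le1.
Qed.

(** The separation half of the Jordan-Brouwer theorem.  For each mesh, label a
    lattice point by the label of a nearest point of the embedded sphere.
    Sperner's lemma gives an odd number of tetrahedra of the cube whose image is
    rainbow, hence a rainbow tetrahedron of the lattice over which the
    approximation has odd degree.  It cannot be near the embedded sphere, since
    the inverse of [f] is uniformly continuous and close points do not have four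
    labels.  Let the mesh go to zero and take a limit [m] of such tetrahedra.
    Away from the embedded sphere the degree is locally constant, uniformly in
    the mesh, so the points with eventually the same degree as [m] form an open
    set whose boundary lies on the embedded sphere; it is bounded because far
    points have degree zero. *)
Theorem bounded_region (f : 'rV[R]_3 -> 'rV[R]_3) :
  {within sphere2 R, continuous f} -> {in sphere2 R &, injective f} ->
  exists V : set 'rV[R]_3, [/\ open V, V !=set0, bounded_set V,
    V `<=` ~` (f @` sphere2 R) & closure V `<=` V `|` f @` sphere2 R].
Proof.
move=> fcont finj.
have [M M0 fM] := sphere2_image_bounded fcont.
have cS := @sphere2_compact R; have S0 := sphere2_nonempty R.
pose T := (nat * (nat -> nat -> nat -> lattice) * (nat -> nat -> nat -> 'rV[R]_3))%type.
have [s sP] := @choice nat T (fun K t => [/\ (0 < t.1.1)%N,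
    forall t', t' \in kuhn t.1.1 t.1.2 -> {in t' &, forall v w, adjacent v w},
    forall i j k, (i <= t.1.1)%N -> (j <= t.1.1)%N -> (k <= t.1.1)%N ->
      `|K.+1%:R^-1 *: point R (t.1.2 i j k)| <= M + 1 &
    forall i j k, on_boundary t.1.1 i j k -> [/\ sphere2 R (t.2 i j k),
      `|K.+1%:R^-1 *: point R (t.1.2 i j k) - f (t.2 i j k)| <= K.+1%:R^-1 &
      on_faces t.1.1 i j k (t.2 i j k)]]) (fun K =>
    let: ex_intro n (ex_intro g (ex_intro u h)) := grid_map fcont fM (ltn0Sn K) in
    ex_intro _ (n, g, u) h).
pose kap K : R := K.+1%:R.
have kap0 K : 0 < kap K by rewrite /kap ltr0n.
have kapV0 K : 0 < (kap K)^-1 by rewrite invr_gt0.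
pose fl K (p : 'rV[R]_3) : lattice := (Num.floor (kap K * p ord0 o0),
  Num.floor (kap K * p ord0 o1), Num.floor (kap K * p ord0 o2)).
pose deg K p := local_degree (s K).1.1 (s K).1.2 (tetra (fl K p) (1,0,0) (1,1,0)).
pose away rho p := forall u, sphere2 R u -> rho <= `|p - f u|.
(* a monotone lattice path between the cubes of two close points stays away
   from the boundary values *)
have stable rho p p' K : 0 < rho -> away rho p -> `|p - p'| < rho / 4 ->
    8 / rho < kap K -> deg K p = deg K p'.
  move=> rho0 prho pp' Krho; have [n0 adjK imK bdK] := sP K.
  have krho : (kap K)^-1 < rho / 8.
    by rewrite -[rho / 8]invrK ltf_pV2 ?posrE ?invr_gt0 ?divr_gt0// invf_div.
  apply: local_degree_path => // x xa xb xc i j k bd; apply/eqP => gx.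
  have [Su ufu _] := bdK i j k bd.
  have := prho _ Su; apply/negP; rewrite -ltNge.
  rewrite gx -/(kap K) in ufu.
  have px : `|p - (kap K)^-1 *: point R (diag x)| <= rho / 4 + (kap K)^-1.
    have le4 l : `|p ord0 l - p' ord0 l| <= rho / 4.
      apply/ltW/(le_lt_trans _ pp'); rewrite (_ : _ - _ = (p - p') ord0 l).
        exact: coord_le_norm.
      by rewrite [RHS]mxE [X in _ = _ + X]mxE.
    have [p0 p1 p2] := row3E ((diag x).1.1%:~R : R) (diag x).1.2%:~R (diag x).2%:~R.
    rewrite distrC; apply: norm_le_coord; first by rewrite addr_ge0 ?divr_ge0 ?ltW.
    apply: ord3_ind; rewrite mxE [X in _ + X]mxE [X in X - _]mxE ?p0 ?p1 ?p2.
    - exact: between_floors (kap0 K) (le4 o0) xa.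
    - exact: between_floors (kap0 K) (le4 o1) xb.
    - exact: between_floors (kap0 K) (le4 o2) xc.
  rewrite -(subrKA ((kap K)^-1 *: point R (diag x))).
  rewrite (le_lt_trans (ler_normD _ _))//.
  rewrite (le_lt_trans (lerD px ufu))//.
  by move: ((kap K)^-1) rho0 krho; clear => z; lra.
pose P K v : 'rV[R]_3 := (kap K)^-1 *: point R v.
have kuhn_bound K t v : t \in kuhn (s K).1.1 (s K).1.2 -> v \in t -> `|P K v| <= M + 1.
  have [n0 adjK imK bdK] := sP K.
  move=> /mem_kuhn[i [j [k [lin ljn lkn tP]]]] /tP[a [b [c E]]].
  have ble (m : nat) (b0 : bool) : (m < (s K).1.1)%N -> (m + b0 <= (s K).1.1)%N.
    by move=> mn; case: b0; rewrite ?addn1// addn0 ltnW.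
  have := imK _ _ _ (ble i a lin) (ble j b ljn) (ble k c lkn).
  by rewrite -E.
have deg_bound K p : deg K p -> `|p| <= M + 2.
  rewrite /deg /local_degree => dp.
  have /hasP[t tk pt] : has (perm_eq (tetra (fl K p) (1,0,0) (1,1,0))) (kuhn (s K).1.1 (s K).1.2).
    by rewrite has_count lt0n; apply: contraTneq dp => ->.
  have flt : fl K p \in t by rewrite -(perm_mem pt) mem_head.
  have h := kuhn_bound K t _ tk flt.
  have k1 : (kap K)^-1 <= 1 by rewrite invf_le1// ler1n.
  have : `|p - P K (fl K p)| <= (kap K)^-1.
    have cl (r : R) : `|r - (kap K)^-1 * (Num.floor (kap K * r))%:~R| <= (kap K)^-1.
      have f1 : (kap K)^-1 * (Num.floor (kap K * r))%:~R <= r by rewrite ler_pdivrMl// floor_le.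
      have f2 : r <= (kap K)^-1 * (Num.floor (kap K * r))%:~R + (kap K)^-1.
        rewrite -[X in _ + X]mulr1 -mulrDr ler_pdivlMl// -[X in _ + X]/(1%:~R) -intrD.
        exact/ltW/floorD1_gt.
      by rewrite ler_norml; apply/andP; split; move: (kapV0 K) f1 f2;
        move: (_ * _%:~R) => y; move: ((kap K)^-1) => z; clear; lra.
    have [p0 p1 p2] := row3E ((fl K p).1.1%:~R : R) (fl K p).1.2%:~R (fl K p).2%:~R.
    apply: norm_le_coord; first exact: ltW.
    by apply: ord3_ind; rewrite mxE [X in _ + X]mxE [X in _ - X]mxE ?p0 ?p1 ?p2; exact: cl.
  move=> h'; rewrite -(subrK (P K (fl K p)) p).
  rewrite (le_trans (ler_normD _ _))//.
  by rewrite (le_trans (lerD h' h))//; move: ((kap K)^-1) k1; clear => z; lra.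
have e10 : 0 < 1/10 :> R by [].
have [d1 d10 d1P] := compact_uniform_injective cS fcont finj e10.
have [q qP] := @choice _ _ (fun p x => sphere2 R x /\
    forall y, sphere2 R y -> `|p - f x| <= `|p - f y|) (fun p =>
    let: ex_intro2 x Sx xP := compact_nearest S0 cS fcont p in
    ex_intro _ x (conj Sx xP)).
pose del := d1 / 4.
(* 16 leaves room: all errors below are at most a few multiples of 1 / kap K *)
have rainbow K : 16 / d1 < kap K ->
    exists p, [/\ `|p| <= M + 1, away del p & deg K p].
  move=> Kd1; have [n0 adjK imK bdK] := sP K.
  have kd1 : (kap K)^-1 < d1 / 16.
    by rewrite -[d1 / 16]invrK ltf_pV2 ?posrE ?invr_gt0 ?divr_gt0// invf_div.
  pose l v := orthant (q (P K v)).
  have q_boundary i j k : on_boundary (s K).1.1 i j k ->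
      `|q (P K ((s K).1.2 i j k)) - (s K).2 i j k| < 1/10.
    move=> /bdK[Su ufu _]; have [Sq qmin] := qP (P K ((s K).1.2 i j k)).
    apply: d1P => //; rewrite -(subrKA (P K ((s K).1.2 i j k))).
    rewrite (le_lt_trans (ler_normD _ _))// distrC.
    rewrite (le_lt_trans (lerD (le_trans (qmin _ Su) ufu) ufu))//.
    by rewrite -/(kap K); move: ((kap K)^-1) kd1 d10; clear => z; lra.
  have q_lo i j k c : on_boundary (s K).1.1 i j k -> (s K).2 i j k ord0 c <= - (1/2) ->
      q (P K ((s K).1.2 i j k)) ord0 c < 0.
    move=> bd uc; have := le_lt_trans (coord_le_norm _ c) (q_boundary i j k bd).
    by rewrite mxE [X in _ + X]mxE ltr_norml => /andP[_]; lra.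
  have q_hi i j k c : on_boundary (s K).1.1 i j k -> 1/2 <= (s K).2 i j k ord0 c ->
      0 <= q (P K ((s K).1.2 i j k)) ord0 c.
    move=> bd uc; have := le_lt_trans (coord_le_norm _ c) (q_boundary i j k bd).
    by rewrite mxE [X in _ + X]mxE ltr_norml => /andP[]; lra.
  have sp : odd (count (fun t => perm_eq t [:: 0; 1; 2; 3]%N)
      (kuhn (s K).1.1 (fun i j k => l ((s K).1.2 i j k)))).
    apply: sperner_cube => [i j k|i j lin ljn|i j lin ljn]; first exact: orthant_lt4.
    - split.
      + have bd : on_boundary (s K).1.1 0 i j by rewrite /on_boundary leq0n lin ljn eqxx.
        have [_ _ [[/(_ erefl) u0 _ _] _]] := bdK _ _ _ bd.
        by rewrite /l /orthant leNgt (q_lo _ _ _ _ bd u0)/=; case: ifP => // _; case: ifP.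
      + have bd : on_boundary (s K).1.1 i 0 j by rewrite /on_boundary leq0n lin ljn eqxx !orbT.
        have [_ _ [[_ /(_ erefl) u0 _] _]] := bdK _ _ _ bd.
        rewrite /l /orthant; case: ifP => // _; rewrite leNgt (q_lo _ _ _ _ bd u0)/=.
        by case: ifP.
      + have bd : on_boundary (s K).1.1 i j 0 by rewrite /on_boundary leq0n lin ljn eqxx !orbT.
        have [_ _ [[_ _ /(_ erefl) u0] _]] := bdK _ _ _ bd.
        rewrite /l /orthant; case: ifP => // _; case: ifP => // _.
        by rewrite leNgt (q_lo _ _ _ _ bd u0).
    - split.
      + have bd : on_boundary (s K).1.1 (s K).1.1 i j
        by rewrite /on_boundary leqnn lin ljn eqxx !orbT.
        have [_ _ [_ [/(_ erefl) u0 _ _]]] := bdK _ _ _ bd.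
        by rewrite /l /orthant (q_hi _ _ _ _ bd u0).
      + have bd : on_boundary (s K).1.1 i (s K).1.1 j
        by rewrite /on_boundary leqnn lin ljn eqxx !orbT.
        have [_ _ [_ [_ /(_ erefl) u0 _]]] := bdK _ _ _ bd.
        by rewrite /l /orthant (q_hi _ _ _ _ bd u0); case: ifP.
      + have bd : on_boundary (s K).1.1 i j (s K).1.1
        by rewrite /on_boundary leqnn lin ljn eqxx !orbT.
        have [_ _ [_ [_ _ /(_ erefl) u0]]] := bdK _ _ _ bd.
        by rewrite /l /orthant (q_hi _ _ _ _ bd u0); case: ifP => // _; case: ifP.
  have [t [v [tk lt vt dvt ob]]] := rainbow_cube adjK sp.
  have taway w : w \in t -> away del (P K w).
    move=> wt u0 Su0; rewrite leNgt; apply/negP => wu0.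
    have ex_z (i : nat) : exists w : lattice, (i < 4)%N -> w \in t /\ l w = i.
      have [i4|_] := boolP (i < 4)%N; last by exists v.
      have : i \in map l t by rewrite (perm_mem lt) !inE; case: i i4 => [|[|[|[|]]]].
      by case/mapP => x xt ->; exists x.
    have [z zP] := @choice _ _ _ ex_z.
    case: (@orthant_far (fun i => q (P K (z i)))).
    - by move=> i; have [] := qP (P K (z i)).
    - move=> i j /zP[zit _] /zP[zjt _].
      have [Sqi qimin] := qP (P K (z i)); have [Sqj qjmin] := qP (P K (z j)).
      have close x y : x \in t -> y \in t -> `|P K x - P K y| <= (kap K)^-1.
        move=> xt yt; rewrite -scalerBr normrZ gtr0_norm// ler_piMr ?(ltW (kapV0 K))//.
        by apply: point_adjacent; apply: (adjK t).
      have near_f x : x \in t -> `|P K x - f (q (P K x))| < del + (kap K)^-1.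
        move=> xt; have [_ /(_ _ Su0)] := qP (P K x) => h; apply: le_lt_trans h _.
        rewrite -(subrKA (P K w)) (le_lt_trans (ler_normD _ _))// addrC.
        by rewrite ltr_leD// close.
      have dij : `|f (q (P K (z i))) - f (q (P K (z j)))| <= `|P K (z i) - f (q (P K (z i)))| +
          (`|P K (z i) - P K (z j)| + `|P K (z j) - f (q (P K (z j)))|).
        rewrite -(subrKA (P K (z i))) (le_trans (ler_normD _ _))//.
        rewrite lerD//; first by rewrite distrC.
        by rewrite -(subrKA (P K (z j)) (P K (z i))) ler_normD.
      apply: d1P => //; apply: le_lt_trans dij _.
      rewrite (lt_le_trans (ltr_leD (near_f _ zit) (lerD (close _ _ zit zjt) (ltW (near_f _ zjt)))))//.
      by move: ((kap K)^-1) kd1 d10; rewrite /del; clear => z0; lra.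
    - by move=> i /zP[].
  exists (P K v); split; [exact: kuhn_bound tk vt|exact: taway|].
  rewrite /deg (_ : fl K (P K v) = v).
    apply: ob => i j k bd; apply/eqP => gE; have [Su ufu _] := bdK _ _ _ bd.
    have := taway _ dvt _ Su; rewrite leNgt; apply/negP/negPn.
    rewrite -gE (le_lt_trans ufu)// -/(kap K) /del.
    by move: ((kap K)^-1) kd1 d10; clear => z; lra.
  have flK (x : int) : Num.floor (kap K * ((kap K)^-1 * x%:~R)) = x.
    by rewrite mulVKf ?gt_eqF// intrKfloor.
  case: v vt dvt ob => [[x y] z] _ _ _.
  have [p0 p1 p2] := row3E (x%:~R : R) y%:~R z%:~R.
  by rewrite /fl /P /point /= !mxE /= !flK.
have big x : exists N : nat, forall K, (N <= K)%N -> x < kap K.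
  exists (Num.bound `|x|) => K NK; apply: le_lt_trans (ler_norm _) _.
  apply: lt_le_trans (archi_boundP (normr_ge0 _)) _.
  by rewrite /kap ler_nat (leq_trans NK).
have [N0 N0P] := big (16 / d1).
have ex_p K : exists x : 'rV[R]_3, (N0 <= K)%N ->
    [/\ `|x| <= M + 1, away del x & deg K x].
  have [/N0P/rainbow[p pP]|_] := boolP (N0 <= K)%N.
    by exists p.
  by exists 0.
have [p pP] := @choice _ _ _ ex_p.
pose C := [set x : 'rV[R]_3 | `|x| <= M + 1].
have cC : compact C.
  apply: bounded_closed_compact; first exact: (@bounded_normP _ _ _ (M + 1)).
  apply: (preimage_closed (f := fun x : 'rV[R]_3 => `|x|) (D := [set r : R | r <= M + 1]));
    last exact: closed_le.
  by move=> x _; exact: norm_continuous.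
have [m [_ mcl]] : C `&` cluster (p @ \oo) !=set0.
  by apply: cC; exists N0 => // K /pP[].
have mfreq e N : 0 < e -> exists2 K, (N <= K)%N & `|m - p K| < e.
  move=> e0; have [||x [[K NK <-] mx]] := mcl [set p K | K in [set K | (N <= K)%N]] (ball m e).
  - by exists N => // K NK; exists K.
  - exact: nbhsx_ballx.
  - by exists K => //; move: mx; rewrite -ball_normE.
have del0 : 0 < del by rewrite divr_gt0.
have away_ball rho x y : away rho x -> `|x - y| < rho / 4 -> away (rho / 2) y.
  move=> rx xy u Su; have := rx u Su; rewrite -(subrKA y) => h.
  have := le_trans h (ler_normD _ _); have := normr_ge0 (x - y); move: xy.
  by move: `|x - y| `|y - f u| => z1 z2; clear; lra.
have del20 : 0 < del / 2 by rewrite divr_gt0.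
have maway : away (del / 2) m.
  have [|K NK mp] := mfreq (del / 4) N0; first by rewrite divr_gt0.
  by have [_ pa _] := pP K NK; apply: away_ball pa _; rewrite distrC.
have mdeg N : exists2 K, (N <= K)%N & deg K m.
  have [N1 N1P] := big (8 / (del / 2)).
  have [|K] := mfreq (del / 2 / 4) (maxn N (maxn N0 N1)); first by rewrite divr_gt0.
  rewrite !geq_max => /and3P[NK N0K N1K] mp; exists K => //.
  by rewrite (stable _ _ _ K del20 maway mp (N1P K N1K)); have [] := pP K N0K.
have exaway x : ~ (f @` sphere2 R) x -> exists2 rho, 0 < rho & away rho x.
  move=> xN; have [u Su uP] := compact_nearest S0 cS fcont x.
  exists `|x - f u| => //; rewrite normr_gt0 subr_eq0; apply/eqP => xu.
  by apply: xN; exists u.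
pose V := [set x | (exists2 rho, 0 < rho & away rho x) /\
  exists N, forall K, (N <= K)%N -> deg K x = deg K m].
have Vball rho x y : 0 < rho -> away rho x -> `|x - y| < rho / 4 ->
    (exists N, forall K, (N <= K)%N -> deg K x = deg K m) <->
    (exists N, forall K, (N <= K)%N -> deg K y = deg K m).
  move=> rho0 rx xy; have [N1 N1P] := big (8 / rho).
  have E K : (N1 <= K)%N -> deg K x = deg K y by move=> /N1P; exact: stable.
  split=> -[N NP]; exists (maxn N N1) => K; rewrite geq_max => /andP[NK N1K].
    by rewrite -E// NP.
  by rewrite E// NP.
exists V; split.
- rewrite openE => x [[rho rho0 rx] dx]; apply/nbhs_ballP.
  exists (rho / 4); rewrite /= ?divr_gt0// => y; rewrite -ball_normE /= => xy.
  split; last exact/(Vball rho x y).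
  by exists (rho / 2); [rewrite divr_gt0|exact: away_ball rx xy].
- by exists m; split; [exists (del / 2)|exists 0%N].
- apply: (@bounded_normP _ _ _ (M + 2)) => x [_ [N NP]].
  by have [K NK dK] := mdeg N; apply: (deg_bound K); rewrite NP.
- move=> x [[rho rho0 rx] _] [u Su ux]; have := rx u Su.
  by rewrite ux subrr normr0 leNgt rho0.
- move=> x clx; have [|xN] := pselect ((f @` sphere2 R) x); first by right.
  left; have [rho rho0 rx] := exaway x xN; split; first by exists rho.
  have rho40 : 0 < rho / 4 by rewrite divr_gt0.
  have [y [[_ dy] xy]] := clx (ball x (rho / 4)) (nbhsx_ballx _ _ rho40).
  by apply/(Vball rho x y) => //; move: xy; rewrite -ball_normE.
Qed.

End Region.

(** * Unicoherence of normed spaces *)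
Section Unicoherence.
Variables (R : realType) (E : normedModType R).
Implicit Types (A B P Q S : set E) (x y z : E).

(** The classes of a locally constant equivalence relation are relatively open
    and closed. *)
Lemma connected_equiv A (e : E -> E -> Prop) :
  connected A -> (forall x y, e x y -> e y x) ->
  (forall x y z, e x y -> e y z -> e x z) ->
  (forall x, A x -> exists2 d, 0 < d & forall y, A y -> `|x - y| < d -> e x y) ->
  forall p q, A p -> A q -> e p q.
Proof.
move=> cA esym etrans eloc p q Ap Aq.
have epp : e p p by have [d d0] := eloc p Ap; apply; rewrite ?subrr ?normr0.
pose nearby (B : set E) := [set y | exists x d, [/\ B x, `|x - y| < d &
  forall z, A z -> `|x - z| < d -> e x z]].
have open_nearby B : open (nearby B).
  rewrite openE => y [x [d [Bx xy dP]]]; apply/nbhs_ballP.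
  exists (d - `|x - y|); rewrite /= ?subr_gt0// => z; rewrite -ball_normE /= => yz.
  exists x, d; split => //; rewrite -(subrKA y) (le_lt_trans (ler_normD _ _))//.
  by rewrite addrC -ltrBrDr.
pose C := A `&` [set y | e p y].
suff CA : C = A by move: Aq; rewrite -CA => -[].
have Cnear : C = A `&` nearby C.
  apply/seteqP; split=> [x [Ax px]|x [Ax [y [d [[Ay py] yx dP]]]]]; split => //.
    by have [d d0 dP] := eloc x Ax; exists x, d; rewrite subrr normr0.
  by apply: etrans py _; exact: dP.
apply: cA; first by exists p.
- by exists (nearby C).
- exists (~` nearby (A `\` C)); first exact: open_closedC.
  apply/seteqP; split=> [x [Ax px]|x [Ax nx]]; split => //.
    move=> [y [d [[Ay nCy] yx dP]]]; apply: nCy; split => //.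
    by apply: etrans px _; apply: esym; exact: dP.
  apply: contrapT => npx; apply: nx; have [d d0 dP] := eloc x Ax.
  by exists x, d; split => //; [split => // -[]|rewrite subrr normr0].
Qed.

Lemma connected_closed_cover S A B : connected S -> closed A -> closed B ->
  S `<=` A `|` B -> S `&` A !=set0 -> S `&` B !=set0 -> S `&` (A `&` B) !=set0.
Proof.
move=> cS clA clB SAB SA [y [Sy By]]; apply: contrapT => nAB.
have SAE : S `&` A = S.
  apply: cS => //; last by exists A.
  exists (~` B); first exact: closed_openC.
  apply/seteqP; split => x [Sx Ax]; split => //.
    by move=> Bx; apply: nAB; exists x.
  by case: (SAB x Sx).
by apply: nAB; exists y; split => //; split => //; have [_] : (S `&` A) y by rewrite SAE.
Qed.

Lemma segment_image_connected x y :
  connected [set x + t *: (y - x) | t in `[0, 1]%classic].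
Proof.
apply: connected_continuous_connected; first exact: segment_connected.
apply: continuous_subspaceT => t; apply: cvgD; first exact: cvg_cst.
by apply: cvgZ; [exact: cvg_id|exact: cvg_cst].
Qed.

Lemma compact_closed_dist P Q : compact P -> closed Q -> P `&` Q = set0 ->
  exists2 d, 0 < d & forall x y, P x -> Q y -> d <= `|x - y|.
Proof.
move=> cP clQ PQ.
have [|x Px|d d0 dP] := @compact_uniform R E P (fun d x => forall y, Q y -> d <= `|x - y|) cP.
- by move=> d d' x d'd h y Qy; exact: le_trans d'd (h y Qy).
- have : nbhs x (~` Q).
    apply: open_nbhs_nbhs; split; first exact: closed_openC.
    by move=> Qx; have : (P `&` Q) x by []; rewrite PQ.
  move=> /nbhs_ballP[d /= d0 dQ]; exists (d / 2); first by rewrite divr_gt0.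
  move=> y Py xy z Qz; rewrite leNgt; apply/negP => yz.
  have := dQ z; rewrite -ball_normE /= => /(_ _ Qz); apply.
  by rewrite [d]splitr -(subrKA y) (le_lt_trans (ler_normD _ _))// ltrD.
- by exists d => // x y Px; exact: dP.
Qed.

(** The primitive of a 1-cocycle [b], obtained by summing it along the segment
    from the origin to [x], cut into [n] pieces. *)
Let cone_sum (b : E -> E -> bool) (n : nat) (m : nat) x : bool :=
  odd (\sum_(k < m) b ((k%:R / n%:R) *: x) ((k.+1%:R / n%:R) *: x)).

(** The quadrilateral between the segments to [x] and to [y] is cut into thin
    triangles, on each of which the cocycle condition holds. *)
Let cone_sumE (b : E -> E -> bool) (e : R) (n m : nat) x y :
  (forall x y z, `|x - y| < e -> `|y - z| < e -> `|x - z| < e ->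
    b x y (+) b y z = b x z) ->
  (0 < n)%N -> (m <= n)%N -> `|x| < n%:R * (e / 2) -> `|y| < n%:R * (e / 2) ->
  `|x - y| < e / 2 ->
  cone_sum b n m x (+) cone_sum b n m y =
  b ((m%:R / n%:R) *: x) ((m%:R / n%:R) *: y).
Proof.
move=> cb n0 mn xn yn xy.
have n0' : 0 < n%:R :> R by rewrite ltr0n.
have e0 : 0 < e / 2 by apply: le_lt_trans xy.
have ee : e / 2 < e by rewrite [ltRHS]splitr ltrDl.
have step k z : `|z| < n%:R * (e / 2) ->
    `|(k%:R / n%:R) *: z - (k.+1%:R / n%:R) *: z| < e / 2.
  move=> zn; rewrite -scalerBl -mulrBl -natr1 opprD addNKr normrZ.
  by rewrite normrM normrN1 mul1r gtr0_norm ?invr_gt0// ltr_pdivrMl.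
have side k : (k <= n)%N -> `|(k%:R / n%:R) *: x - (k%:R / n%:R) *: y| < e / 2.
  move=> kn; rewrite -scalerBr normrZ (le_lt_trans _ xy)// ler_piMl//.
  by rewrite ger0_norm ?divr_ge0// ler_pdivrMr// mul1r ler_nat.
have bxx z : b z z = false.
  have zz : `|z - z| < e by rewrite subrr normr0 (lt_trans e0).
  by have := cb z z z zz zz zz; rewrite addbb.
elim: m mn => [|m IH] mn; first by rewrite /cone_sum !big_ord0 mul0r !scale0r bxx.
have /IH : (m <= n)%N by exact: ltnW.
rewrite /cone_sum !big_ord_recr /= !oddD !oddb.
set X := (m%:R / n%:R) *: x; set Y := (m%:R / n%:R) *: y.
set X' := (m.+1%:R / n%:R) *: x; set Y' := (m.+1%:R / n%:R) *: y => h.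
have xx : `|X - X'| < e / 2 by exact: step.
have yy : `|Y - Y'| < e / 2 by exact: step.
have XY : `|X - Y| < e / 2 by apply: side; exact: ltnW.
have XY' : `|X' - Y'| < e / 2 by exact: side.
have diag : `|X - Y'| < e.
  by rewrite [e]splitr -(subrKA Y) (le_lt_trans (ler_normD _ _))// ltrD.
have lt_e (r : R) : r < e / 2 -> r < e by move=> /lt_trans; apply.
have t1 := cb X X' Y' (lt_e _ xx) (lt_e _ XY') diag.
have t2 := cb X Y Y' (lt_e _ XY) (lt_e _ yy) diag.
move: h t1 t2; case: (odd _); case: (odd _) => /=; case: (b X Y); case: (b X X');
  case: (b X' Y'); case: (b Y Y') => //=; by case: (b X Y').
Qed.

(** If the intersection splits into two pieces [P] and [Q], let [b x y] tell
    whether the short step from [x] to [y] crosses the border of [A] near [P].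
    It is a cocycle modulo 2 at a small scale, so it has a primitive [s].  As
    [A] is connected, [s] takes the same value at a point of [P] and at a point
    of [Q].  On the connected set [B], however, [b] is the coboundary of the
    indicator of [P], which differs at these two points.

    The primitive at [x] needs a number [n] of pieces that grows with the norm
    of [x]; the identities below hold for all large [n]. *)
Lemma unicoherence A B : closed A -> closed B -> connected A -> connected B ->
  A `|` B = setT -> compact (A `&` B) -> connected (A `&` B).
Proof.
move=> clA clB cA cB AB cAB; apply: contrapT => /connectedPn[F [F0 ABF [sF1 sF2]]].
set P := F false in ABF sF1 sF2; set Q := F true in ABF sF1 sF2.
have clAB : closed (A `&` B) by exact: closedI.
have subP : closure P `<=` P.
  move=> x clx; have : (A `&` B) x.
    by apply: clAB; apply: closureS clx; rewrite ABF; exact: subsetUl.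
  rewrite ABF => -[//|Qx]; have : (closure P `&` Q) x by [].
  by rewrite sF1.
have subQ : closure Q `<=` Q.
  move=> x clx; have : (A `&` B) x.
    by apply: clAB; apply: closureS clx; rewrite ABF; exact: subsetUr.
  rewrite ABF => -[Px|//]; have : (P `&` closure Q) x by [].
  by rewrite sF2.
have cP : compact P.
  by apply: subclosed_compact subP cAB _; rewrite ABF; exact: subsetUl.
have PQ : P `&` Q = set0.
  by rewrite -subset0 -sF1 => x [Px Qx]; split => //; exact: subset_closure.
have [d d0 dPQ] := compact_closed_dist cP subQ PQ.
pose e := d / 4; have e0 : 0 < e by rewrite divr_gt0.
pose a x := `[< A x >]; pose nP x := `[< exists2 z, P z & `|x - z| < 2 * e >].
pose b x y := (a x (+) a y) && nP x.
have crossing x y : `|x - y| < e -> a x != a y -> exists2 z, (P `|` Q) z &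
    `|x - z| <= `|x - y|.
  move=> xy axy; pose S := [set x + t *: (y - x) | t in `[0, 1]%classic].
  have Sx : S x by exists 0; rewrite ?scale0r ?addr0//= in_itv /= lexx ler01.
  have Sy : S y by exists 1; rewrite ?scale1r ?subrKC//= in_itv /= lexx ler01.
  have ABx z : ~ A z -> B z by move=> nA; have [] : (A `|` B) z by rewrite AB.
  have [z [[t tI <-]]] : S `&` (A `&` B) !=set0.
    apply: connected_closed_cover => //; first exact: segment_image_connected.
    - by rewrite AB.
    - move: axy; rewrite /a; case: asboolP => [Ax _|nAx]; first by exists x.
      by case: asboolP => // Ay _; exists y.
    - move: axy; rewrite /a; case: asboolP => [Ax|nAx _]; last by exists x; split => //; exact: ABx.
      by case: asboolP => // nAy _; exists y; split => //; exact: ABx.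
  rewrite ABF => z_in; exists (x + t *: (y - x)) => //.
  rewrite opprD addNKr normrN normrZ distrC.
  move: tI; rewrite /= in_itv /= => /andP[t0 t1].
  by rewrite ger0_norm// ler_piMl.
have nPP w x : P w -> `|x - w| < 2 * e -> nP x.
  by move=> Pw xw; apply/asboolP; exists w.
have nPQ w x : Q w -> `|x - w| < 2 * e -> nP x = false.
  move=> Qw xw; apply/asboolP => -[z Pz xz]; have := dPQ _ _ Pz Qw.
  rewrite leNgt (_ : d = 2 * e + 2 * e); last by rewrite /e; lra.
  rewrite -(subrKA x) (le_lt_trans (ler_normD _ _))// ltrD//.
  by rewrite distrC.
have cocycle x y z : `|x - y| < e -> `|y - z| < e -> `|x - z| < e ->
    b x y (+) b y z = b x z.
  move=> xy yz xz; have [/andP[/eqP axy /eqP ayz]|] := boolP ((a x == a y) && (a y == a z)).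
    by rewrite /b axy ayz !addbb.
  rewrite negb_and => naxyz.
  have [w PQw [xw yw]] : exists2 w, (P `|` Q) w & `|x - w| < 2 * e /\ `|y - w| < 2 * e.
    have two (u v w : E) : `|u - v| < e -> `|v - w| < e -> `|u - w| < 2 * e.
      move=> uv vw; rewrite -(subrKA v) (le_lt_trans (ler_normD _ _))//.
      by rewrite mulr_natl mulr2n ltrD.
    have one (u w : E) : `|u - w| < e -> `|u - w| < 2 * e.
      by move=> /lt_trans; apply; rewrite ltr_pMl// ltr1n.
    case/orP: naxyz => [axy|ayz].
      have [w PQw xw] := crossing x y xy axy; have xwe := le_lt_trans xw xy.
      exists w => //; split; first exact: one.
      by apply: two xwe; rewrite distrC.
    have [w PQw yw] := crossing y z yz ayz; have ywe := le_lt_trans yw yz.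
    by exists w => //; split; [exact: two xy ywe|exact: one].
  rewrite /b; case: PQw => [Pw|Qw].
    by rewrite (nPP w x)// (nPP w y)// !andbT; case: (a x); case: (a y); case: (a z).
  by rewrite (nPQ w x)// (nPQ w y)// !andbF.
pose s n x := cone_sum b n n x.
have pot x y : `|x - y| < e / 2 ->
    exists N, forall n, (N <= n)%N -> s n x (+) s n y = b x y.
  move=> xy; exists (Num.bound ((`|x| + `|y|) / (e / 2))).+1 => n Nn.
  have n0 : (0 < n)%N by apply: leq_trans Nn.
  have e20 : 0 < e / 2 by rewrite divr_gt0.
  have nxy : `|x| + `|y| < n%:R * (e / 2).
    rewrite -ltr_pdivrMr// (lt_le_trans (archi_boundP _))//.
      by rewrite divr_ge0 ?addr_ge0// ltW.
    by rewrite ler_nat ltnW.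
  rewrite /s (cone_sumE (e := e))//.
  - by rewrite divff ?scale1r// pnatr_eq0 -lt0n.
  - by apply: le_lt_trans nxy; rewrite lerDl.
  - by apply: le_lt_trans nxy; rewrite lerDr.
have e20 : 0 < e / 2 by rewrite divr_gt0.
have ee : e / 2 < e by rewrite [ltRHS]splitr ltrDl.
(* eventual equality in n of x |-> s n x + c x is a locally constant relation *)
have const_on S (c : E -> bool) : connected S ->
    (forall x y, S x -> S y -> `|x - y| < e / 2 -> b x y = c x (+) c y) ->
    forall x y, S x -> S y ->
    exists N, forall n, (N <= n)%N -> s n x (+) c x = s n y (+) c y.
  move=> cS bS; apply: (connected_equiv cS).
  - by move=> x y [N NP]; exists N => n /NP.
  - move=> x y z [N NP] [N' N'P]; exists (maxn N N') => n.
    by rewrite geq_max => /andP[/NP -> /N'P].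
  - move=> x Sx; exists (e / 2) => // y Sy xy; have [N NP] := pot x y xy.
    exists N => n /NP; rewrite (bS x y)//.
    by case: (s n x); case: (s n y); case: (c x); case: (c y).
have [p Pp] : P !=set0 := F0 false; have [q Qq] : Q !=set0 := F0 true.
have [Ap Bp] : (A `&` B) p by rewrite ABF; left.
have [Aq Bq] : (A `&` B) q by rewrite ABF; right.
have [NA NAP] : exists N, forall n, (N <= n)%N -> s n p (+) false = s n q (+) false.
  apply: (const_on A (fun=> false)) => // x y Ax Ay _.
  by rewrite /b /a !asboolT.
have [NB NBP] : exists N, forall n, (N <= n)%N ->
    s n p (+) `[< P p >] = s n q (+) `[< P q >].
  apply: (const_on B (fun x => `[< P x >])) => // x y Bx By xy.
  have aE z : B z -> a z = `[< (A `&` B) z >].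
    by move=> Bz; apply/asboolP/asboolP => [|[]].
  rewrite /b !aE// ABF.
  have cl w z : `|w - z| < e / 2 -> P w -> nP z.
    move=> wz Pw; apply: (nPP w) => //; rewrite distrC (lt_trans wz)// (lt_trans ee)//.
    by rewrite ltr_pMl// ltr1n.
  have clQ w z : `|w - z| < e / 2 -> Q w -> nP z = false.
    move=> wz Qw; apply: (nPQ w) => //; rewrite distrC (lt_trans wz)// (lt_trans ee)//.
    by rewrite ltr_pMl// ltr1n.
  have yx : `|y - x| < e / 2 by rewrite distrC.
  have xx : `|x - x| < e / 2 by rewrite subrr normr0.
  have nPx : P y -> Q x -> False by move=> Py Qx; have := cl _ _ yx Py; rewrite (clQ _ _ xx Qx).
  have PQF z : P z -> Q z -> False by move=> Pz Qz; have : (P `&` Q) z by []; rewrite PQ.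
  have [Px|nPx'] := asboolP (P x).
    rewrite (cl x x)// andbT asboolT; last by left.
    have [Py|nPy] := asboolP (P y); first by rewrite asboolT//; left.
    rewrite asboolF// => -[//|Qy]; have := cl _ _ xy Px.
    by rewrite (clQ y y)// subrr normr0.
  have [Qx|nQx] := asboolP (Q x).
    rewrite (clQ x x)// andbF; case: asboolP => // Py.
    by case: (nPx Py Qx).
  rewrite asboolF; last by case.
  have [Py|nPy] := asboolP (P y).
    by rewrite asboolT ?(cl y x)//; left.
  have [Qy|nQy] := asboolP (Q y); first by rewrite (clQ y x)// andbF.
  by rewrite asboolF// => -[].
have := NAP (maxn NA NB) (leq_maxl _ _); have := NBP (maxn NA NB) (leq_maxr _ _).
rewrite asboolT// asboolF; last by move=> Pq; have : (P `&` Q) q by []; rewrite PQ.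
by case: (s _ p); case: (s _ q).
Qed.

End Unicoherence.

(** * Components of open sets and of their complements *)
Section Components.
Variables (R : realType) (E : normedModType R).
Implicit Types (D S W : set E) (x y z : E).

Lemma star_connected S x : S x ->
  (forall y t, S y -> 0 <= t <= 1 -> S (x + t *: (y - x))) -> connected S.
Proof.
move=> Sx star.
have -> : S = \bigcup_(y in S) [set x + t *: (y - x) | t in `[0, 1]%classic].
  apply/seteqP; split=> [y Sy|_ [y Sy [t tI <-]]].
    by exists y => //; exists 1; rewrite ?scale1r ?subrKC//= in_itv /= lexx ler01.
  by apply: star => //; move: tI; rewrite /= in_itv.
apply: bigcup_connected => [|y _]; last exact: segment_image_connected.
by exists x => y _; exists 0; rewrite ?scale0r ?addr0//= in_itv /= lexx ler01.
Qed.

Lemma normed_connected : connected [set: E].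
Proof. exact: (@star_connected setT 0). Qed.

Lemma ball_connected x d : 0 < d -> connected (ball x d).
Proof.
move=> d0; apply: (@star_connected _ x); first exact: ballxx.
move=> y t; rewrite -ball_normE /= => xy /andP[t0 t1].
rewrite opprD addNKr normrN normrZ distrC ger0_norm//.
by rewrite (le_lt_trans _ xy)// ler_piMl.
Qed.

Lemma ball_component W x d : 0 < d -> ball x d `<=` W ->
  ball x d `<=` connected_component W x.
Proof.
move=> d0 xW; apply: connected_component_max => //; first exact: ballxx.
exact: ball_connected.
Qed.

Lemma component_open W x : open W -> open (connected_component W x).
Proof.
rewrite !openE => oW y Cy.
have /oW/nbhs_ballP[d /= d0 dW] := connected_component_sub Cy.
apply/nbhs_ballP; exists d => //= z yz.
apply: connected_component_trans Cy _; exact: ball_component dW _ yz.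
Qed.

Lemma component_closure W x y : open W -> W y ->
  closure (connected_component W x) y -> connected_component W x y.
Proof.
rewrite openE => oW /oW/nbhs_ballP[d /= d0 dW] cly.
have [z [Cz yz]] := cly (ball y d) (nbhsx_ballx _ _ d0).
apply: connected_component_trans Cz _; apply: connected_component_sym.
exact: ball_component dW _ yz.
Qed.

(** Every component of the complement of [D] touches [D], so removing one of
    them leaves the others attached to the connected set [D]. *)
Lemma component_compl_connected D x : closed D -> connected D -> D !=set0 ->
  ~ D x -> connected (~` connected_component (~` D) x).
Proof.
move=> clD cD [p Dp] nDx; set O := connected_component _ _.
have oW : open (~` D) by exact: closed_openC.
have OW : O `<=` ~` D by exact: connected_component_sub.
have Op : ~ O p by move=> /OW; apply.
(* around a point of F there is a ball in the complement of D; it misses O, a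
   component of that complement, so F is open and closed in the whole space *)
have clopen0 (F G H : set E) : open G -> closed H -> F = ~` O `&` G ->
    F = ~` O `&` H -> F `&` D = set0 -> F = set0.
  move=> oG clH FG FH FD; apply/seteqP; split => // z Fz.
  suff FT : F = setT by rewrite -FD FT; move: FD; rewrite FT => /seteqP[/(_ p)];
    rewrite setTI => /(_ Dp).
  apply: normed_connected; first by exists z.
  - exists F; last by rewrite setTI.
    rewrite openE => y Fy; have [nOy Gy] : (~` O `&` G) y by rewrite -FG.
    have Wy : (~` D) y by move=> Dy; have : (F `&` D) y by []; rewrite FD.
    have : nbhs y (G `&` ~` D).
      by apply: open_nbhs_nbhs; split; [exact: openI|].
    move=> /nbhs_ballP[d /= d0 dGW]; apply/nbhs_ballP; exists d => //= u yu.
    rewrite FG; split; last by have [] := dGW u yu.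
    move=> Ou; apply: nOy; apply: connected_component_trans Ou _.
    apply: connected_component_sym; apply: (ball_component d0) yu.
    by move=> v /dGW[].
  - exists F; last by rewrite setTI.
    rewrite FH; apply: closedI => //; apply: open_closedC; exact: component_open.
move=> F [y Fy] [G oG FG] [H clH FH].
have FO z : F z -> ~ O z by rewrite FG => -[].
have [[z [Fz Dz]]|nFD] := pselect (F `&` D !=set0); last first.
  have F0 : F = set0.
    by apply: (clopen0 F G H) => //; apply/seteqP; split => // z FDz; apply: nFD; exists z.
  by move: Fy; rewrite F0.
have DO z' : D z' -> ~ O z' by move=> ? /OW.
have DF : D `&` F = D.
  apply: cD; first by exists z.
  - exists G => //; rewrite FG setIA; congr (_ `&` _).
    by apply/setIidPl => z'; exact: DO.
  - exists H => //; rewrite FH setIA; congr (_ `&` _).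
    by apply/setIidPl => z'; exact: DO.
apply/seteqP; split => [z' /FO//|z' nOz'].
apply: contrapT => nFz'.
have : (~` O `\` F) z' by [].
rewrite (clopen0 (~` O `\` F) (~` H) (~` G))//.
- exact: closed_openC.
- exact: open_closedC.
- by rewrite FH; apply/seteqP; split=> u [nOu nu]; split => //;
  [move=> Hu|move=> [_ Hu]]; apply: nu.
- by rewrite FG; apply/seteqP; split=> u [nOu nu]; split => //;
  [move=> Hu|move=> [_ Hu]]; apply: nu.
- by apply/seteqP; split=> // u [[_ nFu] Du]; apply: nFu; move: Du; rewrite -{1}DF => -[].
Qed.

End Components.

(** * Boundaries and radius-preserving maps of the plane *)
Section Plane.
Variable R : realType.

(** In the maximum norm, the exterior of a ball is a union of half-planes
    bounded by parallels to the axes, and any two of them that are bounded by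
    perpendicular lines meet. *)
Lemma exterior_component (M : R) (W : set 'rV[R]_2) : 0 <= M ->
  (forall x, M < `|x| -> W x) ->
  forall x, M < `|x| -> connected_component W (const_mx (M + 1)) x.
Proof.
move=> M0 XW x Mx.
pose H (s : R) (i : 'I_2) := [set y : 'rV[R]_2 | M < s * y ord0 i].
have HW (s : R) i : `|s| = 1 -> H s i `<=` W.
  move=> s1 y; rewrite /H /= => My; apply: XW; apply: lt_le_trans My _.
  rewrite (le_trans (ler_norm _))// normrM s1 mul1r; exact: coord_le_norm.
have cH s i y : H s i y -> connected (H s i).
  move=> Hy; apply: (star_connected Hy) => z t Hz /andP[t0 t1].
  rewrite /H /= in Hy Hz *; rewrite !mxE.
  have -> : s * (y ord0 i + t * (z ord0 i - y ord0 i)) =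
    (1 - t) * (s * y ord0 i) + t * (s * z ord0 i) by ring.
  have [->|t1'] := eqVneq t 1; first by rewrite subrr mul0r add0r mul1r.
  have t1'' : 0 < 1 - t by rewrite subr_gt0 lt_neqAle t1'.
  rewrite (_ : M = (1 - t) * M + t * M); last by ring.
  by rewrite ltr_leD ?ltr_pM2l// ler_wpM2l// ltW.
have step s i y z : `|s| = 1 -> H s i y -> H s i z -> connected_component W y z.
  move=> s1 Hy Hz; apply: (@connected_component_max _ _ (H s i)) => //; first exact: HW.
  exact: cH Hy.
have M1 : M < M + 1 by rewrite ltrDl.
have [i Mi] : exists i, M < `|x ord0 i|.
  apply: contrapT => nex; move: Mx; apply/negP; rewrite -leNgt.
  by apply: norm_le_coord => // i; rewrite leNgt; apply/negP => ?; apply: nex; exists i.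
have [xi|xi] := leP 0 (x ord0 i).
  apply: (step 1 i); rewrite ?normr1// /H /= mul1r ?mxE//.
  by rewrite ger0_norm in Mi.
pose w : 'rV[R]_2 := \row_j (if j == i then - (M + 1) else M + 1).
apply: (@connected_component_trans _ _ w).
  apply: (step 1 (rev_ord i)); rewrite ?normr1// /H /= mul1r ?mxE//.
  by case: i {Mi xi w} => [[|[|//]] h].
apply: (step (-1) i); rewrite ?normrN1// /H /= mulN1r ?mxE ?eqxx ?opprK//.
by rewrite ltr0_norm in Mi.
Qed.

(** Let [U1] be the component of the origin in [U], [O] the unbounded component
    of the complement of its closure, and [C] the boundary of [O].  By
    unicoherence [C] is connected, and it separates the origin from infinity.
    Join [C] to the origin by the segment from its innermost point [q], and to
    infinity by the ray from its outermost point [p].  The image under [T] of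
    this connected set still joins the origin to infinity, so it meets [C] at
    some [T y].  As [T] preserves the radius, and all radii on [C] lie between
    those of [q] and [p], the point [y] is in [C]. *)
Lemma boundary_meets_image (U : set 'rV[R]_2) (T : 'rV[R]_2 -> 'rV[R]_2) :
  open U -> bounded_set U -> U 0 -> continuous T ->
  (forall x, sqn (T x) = sqn x) ->
  exists y, (closure U `\` U) y /\ (closure U `\` U) (T y).
Proof.
move=> oU /ex_strict_bound_gt0[M M0 UM] U0 cT sT.
have clM : closure U `<=` [set x | `|x| <= M].
  have clB : closed [set x : 'rV[R]_2 | `|x| <= M].
    apply: (preimage_closed (f := fun x : 'rV[R]_2 => `|x|) (D := [set r : R | r <= M]));
      last exact: closed_le.
    by move=> x _; exact: norm_continuous.
  by move=> x clx; apply: clB; apply: closureS clx => y /UM/ltW.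
pose U1 := connected_component U 0; pose D := closure U1; pose W := ~` D.
pose e : 'rV[R]_2 := const_mx (M + 1); pose O := connected_component W e.
have oU1 : open U1 by exact: component_open.
have U1U : U1 `<=` U by exact: connected_component_sub.
have U10 : U1 0 by exact: connected_component_refl.
have D0 : D 0 by exact: subset_closure.
have farW x : M < `|x| -> W x.
  by move=> Mx /(closureS U1U)/clM; rewrite /= leNgt Mx.
have eM : M < `|e|.
  by rewrite (lt_le_trans _ (coord_le_norm _ ord0))// mxE gtr0_norm ?ltrDl// addr_gt0.
have farO x : M < `|x| -> O x by move=> Mx; exact: exterior_component (ltW M0) farW x Mx.
have oO : open O by apply: component_open; exact/closed_openC/closed_closure.
have OW : O `<=` W by exact: connected_component_sub.
pose C := ~` O `&` closure O.
have CU : C `<=` closure U `\` U.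
  move=> x [nOx clOx].
  have Dx : D x.
    apply: contrapT => Wx; apply: nOx; apply: component_closure => //.
    exact/closed_openC/closed_closure.
  split; first exact: closureS Dx.
  move=> Ux; have U1x : U1 x by exact: component_closure.
  have [y [Oy U1y]] := clOx U1 (open_nbhs_nbhs (conj oU1 U1x)).
  by apply: OW Oy _; exact: subset_closure.
have cC : compact C.
  apply: bounded_closed_compact.
    by apply: (@bounded_normP _ _ _ M) => x /CU[/clM].
  by apply: closedI; [exact: open_closedC|exact: closed_closure].
have nO0 : ~ O 0 by move=> /OW; apply.
have connC : connected C.
  apply: unicoherence => //.
  - exact: open_closedC.
  - exact: closed_closure.
  - apply: component_compl_connected.
    + exact: closed_closure.
    + exact/connected_closure/component_connected.
    + by exists 0.
    + exact: farW.
  - exact/connected_closure/component_connected.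
  - apply/seteqP; split => // x _; have [Ox|nOx] := pselect (O x); last by left.
    by right; exact: subset_closure.
have sep (S : set 'rV[R]_2) : connected S -> S 0 -> S `&` O !=set0 -> S `&` C !=set0.
  move=> cS S0 [x [Sx Ox]]; apply: connected_closed_cover => //.
  - exact: open_closedC.
  - exact: closed_closure.
  - move=> y _; have [Oy|nOy] := pselect (O y); last by left.
    by right; exact: subset_closure.
  - by exists 0.
  - by exists x; split => //; exact: subset_closure.
have C0 : C !=set0.
  have [|||x [_ Cx]] := sep [set 0 + t *: (e - 0) | t in `[0, 1]%classic].
  - exact: segment_image_connected.
  - by exists 0; rewrite ?scale0r ?addr0//= in_itv /= lexx ler01.
  - exists e; split; last exact: farO.
    by exists 1; rewrite ?scale1r ?add0r ?subr0//= in_itv /= lexx ler01.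
  - by exists x.
have csq : {within C, continuous (@sqn R 2)}.
  by apply: continuous_subspaceT; exact: sqn_continuous.
have [q qC qmin] := compact_EVT_min C0 cC csq.
have [p pC pmax] := compact_EVT_max C0 cC csq.
rewrite inE in qC; rewrite inE in pC.
have sC x : C x -> 0 < sqn x.
  by move=> Cx; rewrite sqn_gt0; apply/eqP => x0; have [_] := CU x Cx; rewrite x0.
pose seg := [set 0 + t *: (q - 0) | t in `[0, 1]%classic].
pose ray := [set t *: p | t in `[1, +oo[%classic].
have conn_seg : connected seg by exact: segment_image_connected.
have conn_ray : connected ray.
  apply: connected_continuous_connected.
    by apply/connected_intervalP; exact: interval_is_interval.
  apply: continuous_subspaceT => t.
  by apply: cvgZ; [exact: cvg_id|exact: cvg_cst].
have seg0 : seg 0 by exists 0; rewrite ?scale0r ?addr0//= in_itv /= lexx ler01.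
have segq : seg q by exists 1; rewrite ?scale1r ?add0r ?subr0//= in_itv /= lexx ler01.
have rayp : ray p by exists 1; rewrite ?scale1r//= in_itv /= lexx.
have connS : connected (C `|` seg `|` ray).
  apply: connectedU => //; first by exists p; split => //; left.
  by apply: connectedU => //; exists q.
have connTS : connected (T @` (C `|` seg `|` ray)).
  by apply: connected_continuous_connected => //; exact: continuous_subspaceT.
have [||_ [[y Sy <-] CTy]] := sep _ connTS.
- exists 0; first by left; right.
  by apply/eqP; rewrite -sqn_eq0 sT sqn_eq0.
- pose t := Num.max 1 (2 * M ^+ 2 / sqn p + 1).
  have t1 : 1 <= t by rewrite le_max lexx.
  have sp0 := sC p pC.
  exists (T (t *: p)); split.
    by exists (t *: p) => //; right; exists t => //=; rewrite in_itv /= t1.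
  apply: farO; rewrite ltNge; apply/negP => TM.
  have := sqn_le_norm (T (t *: p)); rewrite sT sqnZ leNgt => /negP; apply.
  apply: (@le_lt_trans _ _ (2 * M ^+ 2)).
    by rewrite ler_wpM2l// lerXn2r ?nnegrE// ltW.
  rewrite -ltr_pdivrMr// (@lt_le_trans _ _ (2 * M ^+ 2 / sqn p + 1))// ?ltrDl//.
  by rewrite (@le_trans _ _ t)// ?le_max ?lexx ?orbT// expr2 ler_peMr// (le_trans _ t1).
suff Cy : C y by exists y; split; exact: CU.
have sTy : sqn (T y) = sqn y by rewrite sT.
case: Sy => [[//|[t tI yE]]|[t tI yE]].
  move: tI; rewrite /= in_itv /= => /andP[t0 t1].
  have := qmin (T y); rewrite inE => /(_ CTy); rewrite sTy -yE add0r subr0 sqnZ.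
  rewrite -[leLHS]mul1r (ler_pM2r (sC q qC)) => tt.
  have t1' : t = 1.
    apply/eqP; rewrite eq_le t1 leNgt; apply/negP => tlt1.
    by move: tt; rewrite leNgt expr_lt1// tlt1.
  by rewrite t1' scale1r.
move: tI; rewrite /= in_itv /= andbT => t1.
have := pmax (T y); rewrite inE => /(_ CTy); rewrite sTy -yE sqnZ.
rewrite -[leRHS]mul1r (ler_pM2r (sC p pC)) => tt.
have t1' : t = 1.
  apply/eqP; rewrite eq_le t1 andbT leNgt; apply/negP => tgt1.
  by move: tt; rewrite leNgt expr_gt1// ?tgt1// (le_trans _ t1).
by rewrite t1' scale1r.
Qed.
End Plane.

(** * Chords through a point and their twists *)
Section Geometry.
Variable R : realType.

Definition dot n (x y : 'rV[R]_n) : R := \sum_(i < n) x ord0 i * y ord0 i.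

Lemma dotC n (x y : 'rV[R]_n) : dot x y = dot y x.
Proof. by apply: eq_bigr => i _; rewrite mulrC. Qed.

Lemma dotDl n (x y z : 'rV[R]_n) : dot (x + y) z = dot x z + dot y z.
Proof. by rewrite /dot -big_split /=; apply: eq_bigr => i _; rewrite mxE mulrDl. Qed.

Lemma dotZl n a (x z : 'rV[R]_n) : dot (a *: x) z = a * dot x z.
Proof. by rewrite /dot mulr_sumr; apply: eq_bigr => i _; rewrite mxE mulrA. Qed.

Lemma dotDr n (x y z : 'rV[R]_n) : dot x (y + z) = dot x y + dot x z.
Proof. by rewrite dotC dotDl !(dotC x). Qed.

Lemma dotZr n a (x z : 'rV[R]_n) : dot x (a *: z) = a * dot x z.
Proof. by rewrite dotC dotZl dotC. Qed.

Lemma sqn_dot n (x : 'rV[R]_n) : sqn x = dot x x.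
Proof. by apply: eq_bigr => i _; rewrite expr2. Qed.

Lemma sqnN n (x : 'rV[R]_n) : sqn (- x) = sqn x.
Proof. by rewrite -scaleN1r sqnZ sqrrN expr1n mul1r. Qed.

Lemma sqnD_orthogonal n (x y : 'rV[R]_n) : dot x y = 0 ->
  sqn (x + y) = sqn x + sqn y.
Proof.
by move=> xy; rewrite !sqn_dot dotDl !dotDr (dotC y x) xy addr0 add0r.
Qed.

Lemma dot3E (x y : 'rV[R]_3) : dot x y =
  x ord0 o0 * y ord0 o0 + x ord0 o1 * y ord0 o1 + x ord0 o2 * y ord0 o2.
Proof.
rewrite /dot !big_ord_recl big_ord0 addr0 addrA.
rewrite (_ : lift ord0 ord0 = o1); last exact: val_inj.
by rewrite (_ : lift ord0 _ = o2)//; exact: val_inj.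
Qed.

Definition orthonormal (u w : 'rV[R]_3) : Prop :=
  [/\ sqn u = 1, sqn w = 1 & dot u w = 0].

Lemma orthonormal_complement (z : 'rV[R]_3) : z != 0 ->
  exists u w, [/\ orthonormal u w, dot z u = 0 & dot z w = 0].
Proof.
move=> z0; set a := z ord0 o0; set b := z ord0 o1; set c := z ord0 o2.
have [u0 [u0_neq0 zu0]] : exists u0 : 'rV[R]_3, u0 != 0 /\ dot z u0 = 0.
  have [/andP[/eqP a0 /eqP b0]|ab] := boolP ((a == 0) && (b == 0)).
    exists (row3 1 0 0); have [e0 e1 e2] := row3E (1 : R) 0 0; split.
      by apply/eqP => /rowP/(_ o0); rewrite e0 mxE => /eqP; rewrite oner_eq0.
    by rewrite dot3E e0 e1 e2 -/a a0; ring.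
  exists (row3 (- b) a 0); have [e0 e1 e2] := row3E (- b) a 0; split.
    apply: contra ab => /eqP /rowP h; have := h o0; have := h o1.
    by rewrite e0 e1 !mxE => -> /eqP; rewrite oppr_eq0 => ->; rewrite eqxx.
  by rewrite dot3E e0 e1 e2 -/a -/b; ring.
pose d := u0 ord0 o0; pose e := u0 ord0 o1; pose g := u0 ord0 o2.
pose w0 := row3 (b * g - c * e) (c * d - a * g) (a * e - b * d).
have [e0 e1 e2] := row3E (b * g - c * e) (c * d - a * g) (a * e - b * d).
have zu : a * d + b * e + c * g = 0 by move: zu0; rewrite dot3E.
have zw0 : dot z w0 = 0 by rewrite dot3E e0 e1 e2 -/a -/b -/c; ring.
have uw0 : dot u0 w0 = 0 by rewrite dot3E e0 e1 e2 -/d -/e -/g; ring.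
have w0_neq0 : w0 != 0.
  rewrite -sqn_eq0 sqn_dot dot3E e0 e1 e2.
  have -> : (b * g - c * e) * (b * g - c * e) + (c * d - a * g) * (c * d - a * g) +
    (a * e - b * d) * (a * e - b * d) = sqn z * sqn u0 - (a * d + b * e + c * g) ^+ 2.
    by rewrite !sqn_dot !dot3E -/a -/b -/c -/d -/e -/g; ring.
  by rewrite zu expr0n subr0 mulf_neq0 ?sqn_eq0.
exists (direction u0), (direction w0); split.
- split; [exact/sphere2P/sphere2_direction|exact/sphere2P/sphere2_direction|].
  by rewrite /direction dotZl dotZr uw0 !mulr0.
- by rewrite /direction dotZr zu0 mulr0.
- by rewrite /direction dotZr zw0 mulr0.
Qed.

Definition plane (u w : 'rV[R]_3) (y : 'rV[R]_2) : 'rV[R]_3 :=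
  y ord0 ord0 *: u + y ord0 ord_max *: w.

Lemma sqn2E (y : 'rV[R]_2) : sqn y = y ord0 ord0 ^+ 2 + y ord0 ord_max ^+ 2.
Proof.
by rewrite /sqn big_ord_recl big_ord1; congr (_ + y _ _ ^+ _); exact: val_inj.
Qed.

Lemma planeB u w x y : plane u w (x - y) = plane u w x - plane u w y.
Proof. by rewrite /plane !mxE !scalerBl opprD addrACA. Qed.

Lemma planeN u w y : plane u w (- y) = - plane u w y.
Proof. by rewrite /plane !mxE !scaleNr opprD. Qed.

Let coord_scale_continuous n m i (u : 'rV[R]_m) :
  continuous (fun y : 'rV[R]_n => y ord0 i *: u).
Proof.
move=> y; apply: (@cvgZ _ _ _ (nbhs y) _ (fun y : 'rV[R]_n => y ord0 i) (fun=> u)).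
  exact: coord_continuous.
exact: cvg_cst.
Qed.

Lemma plane_continuous u w : continuous (plane u w).
Proof.
move=> y; apply: (@cvgD _ _ _ (nbhs y) _ (fun y : 'rV[R]_2 => y ord0 ord0 *: u)
  (fun y : 'rV[R]_2 => y ord0 ord_max *: w)); exact: coord_scale_continuous.
Qed.

Lemma sqn_plane u w y : orthonormal u w -> sqn (plane u w y) = sqn y.
Proof.
move=> [u1 w1 uw]; rewrite /plane sqnD_orthogonal; last first.
  by rewrite dotZl dotZr uw !mulr0.
by rewrite !sqnZ u1 w1 !mulr1 sqn2E.
Qed.

Lemma dot_plane z u w y : dot z u = 0 -> dot z w = 0 -> dot z (plane u w y) = 0.
Proof. by move=> zu zw; rewrite /plane dotDr !dotZr zu zw !mulr0 addr0. Qed.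

(** The planar statement applied to the slice of [V] by the plane through [m]
    spanned by [u] and [w]. *)
Lemma plane_boundary (V : set 'rV[R]_3) (m u w : 'rV[R]_3) T :
  open V -> bounded_set V -> V m -> orthonormal u w -> continuous T ->
  (forall y, sqn (T y) = sqn y) ->
  exists y, (closure V `\` V) (m + plane u w y) /\
            (closure V `\` V) (m + plane u w (T y)).
Proof.
move=> oV /ex_strict_bound_gt0[M M0 VM] Vm uw cT sT.
pose g y := m + plane u w y.
have cg : continuous g.
  move=> y; apply: (@cvgD _ _ _ (nbhs y) _ (fun=> m) (plane u w)).
    exact: cvg_cst.
  exact: plane_continuous.
pose U := g @^-1` V.
have [|||y [[clUy nUy] [clUTy nUTy]]] := @boundary_meets_image R U T _ _ _ cT sT.
- by apply: open_comp => // y _; exact: cg.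
- apply: (@bounded_normP _ _ _ (3 * (M + `|m|))) => y /VM /= yM.
  have pM : `|plane u w y| <= M + `|m|.
    rewrite -[plane u w y](addKr m) addrC (le_trans (ler_normB _ _))//.
    by rewrite lerD// ltW.
  have M10 : 0 <= M + `|m| by rewrite addr_ge0// ltW.
  rewrite -(@ler_pXn2r _ 2)// ?nnegrE ?mulr_ge0//.
  rewrite (le_trans (sqr_norm_le_sqn _))// -(sqn_plane y uw).
  rewrite (le_trans (sqn_le_norm _))// exprMn ler_pM//; first by rewrite expr2; lra.
  by rewrite ler_pXn2r ?nnegrE.
- by rewrite /U /g /= /plane !mxE !scale0r !addr0.
have clg z : closure U z -> closure V (g z).
  by move=> clz B /cg/clz[z' [Uz' Bz']]; exists (g z').
by exists y; split; split => //; exact: clg.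
Qed.

Definition quarter_turn (y : 'rV[R]_2) : 'rV[R]_2 :=
  y ord0 ord0 *: delta_mx ord0 ord_max - y ord0 ord_max *: delta_mx ord0 ord0.

Lemma quarter_turn_continuous : continuous quarter_turn.
Proof.
move=> y; apply: (@cvgB _ _ _ (nbhs y) _
  (fun y : 'rV[R]_2 => y ord0 ord0 *: delta_mx ord0 ord_max)
  (fun y : 'rV[R]_2 => y ord0 ord_max *: delta_mx ord0 ord0));
  exact: coord_scale_continuous.
Qed.

Lemma sqn_quarter_turn (a b : R) (y : 'rV[R]_2) :
  sqn (a *: y + b *: quarter_turn y) = (a ^+ 2 + b ^+ 2) * sqn y.
Proof. by rewrite !sqn2E !mxE /=; ring. Qed.

(** The rotation by the angle whose chord has length [2 h] at the radius of
    [y], where [h2] is the square of [h].  The cosine of that angle is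
    [1 - 2 * h2 / sqn y] when the radius is at least [h]; the maximum extends it
    continuously by the half turn inside the circle of radius [h]. *)
Definition twist (h2 : R) (y : 'rV[R]_2) : 'rV[R]_2 :=
  let a := 1 - 2 * (h2 / Num.max h2 (sqn y)) in
  a *: y + Num.sqrt (1 - a ^+ 2) *: quarter_turn y.

Lemma twist_angle h2 (y : 'rV[R]_2) : 0 < h2 ->
  0 <= h2 / Num.max h2 (sqn y) <= 1.
Proof.
move=> h0; have m0 : 0 < Num.max h2 (sqn y) by rewrite lt_max h0.
by rewrite divr_ge0 ?(ltW h0) ?(ltW m0)//= ler_pdivrMr// mul1r le_max lexx.
Qed.

Lemma twist_continuous h2 : 0 < h2 -> continuous (twist h2).
Proof.
move=> h0 y.
have ca : {for y, continuous (fun y => 1 - 2 * (h2 / Num.max h2 (sqn y)))}.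
  pose k r : R := 1 - 2 * (h2 / Num.max h2 r).
  apply: (@continuous_comp _ _ _ (@sqn R 2) k); first exact: sqn_continuous.
  apply: cvgB; first exact: cvg_cst.
  apply: cvgM; first exact: cvg_cst.
  apply: cvgM; first exact: cvg_cst.
  apply: cvgV; first by rewrite gt_eqF// lt_max h0.
  apply: (@continuous_max R R (fun=> h2) id (sqn y)); [exact: cvg_cst|exact: cvg_id].
apply: (@cvgD _ _ _ (nbhs y) _
  (fun y => (1 - 2 * (h2 / Num.max h2 (sqn y))) *: y)
  (fun y => Num.sqrt (1 - (1 - 2 * (h2 / Num.max h2 (sqn y))) ^+ 2) *: quarter_turn y)).
  apply: (@cvgZ _ _ _ (nbhs y) _ (fun y => 1 - 2 * (h2 / Num.max h2 (sqn y))) id).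
    exact: ca.
  exact: cvg_id.
apply: (@cvgZ _ _ _ (nbhs y) _
  (fun y => Num.sqrt (1 - (1 - 2 * (h2 / Num.max h2 (sqn y))) ^+ 2)) quarter_turn).
  pose k r : R := Num.sqrt (1 - r ^+ 2).
  apply: (@continuous_comp _ _ _ (fun y => 1 - 2 * (h2 / Num.max h2 (sqn y))) k) => //.
  apply: (@continuous_comp R R R (fun r : R => 1 - r ^+ 2) Num.sqrt).
    by apply: cvgB; [exact: cvg_cst|exact: exprn_continuous].
  exact: sqrt_continuous.
exact: quarter_turn_continuous.
Qed.

Lemma sqn_twist h2 y : 0 < h2 -> sqn (twist h2 y) = sqn y.
Proof.
move=> /(twist_angle y) /andP[r0 r1]; rewrite /twist sqn_quarter_turn sqr_sqrtr.
  by rewrite subrKC mul1r.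
by move: (h2 / _) r0 r1 => r r0 r1; nra.
Qed.

Lemma twist_dist h2 y : 0 < h2 -> h2 <= sqn y -> sqn (y - twist h2 y) = 4 * h2.
Proof.
move=> h0 hy; have /andP[r0 r1] := twist_angle y h0.
have rE : h2 / Num.max h2 (sqn y) * sqn y = h2.
  by rewrite max_r// divfK// gt_eqF// (lt_le_trans h0).
rewrite /twist; set r := h2 / _ in r0 r1 rE *.
set a := 1 - 2 * r; set v := quarter_turn y.
have -> : y - (a *: y + Num.sqrt (1 - a ^+ 2) *: v) =
    (1 - a) *: y + (- Num.sqrt (1 - a ^+ 2)) *: v.
  by rewrite opprD addrA [in RHS]scalerBl scale1r scaleNr.
rewrite /v sqn_quarter_turn sqrrN sqr_sqrtr; last by rewrite /a; nra.
by rewrite -rE /a; ring.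
Qed.

Lemma twist_small h2 y : 0 < h2 -> sqn y <= h2 -> twist h2 y = - y.
Proof.
move=> h0 yh; rewrite /twist max_l// divff ?gt_eqF//.
rewrite (_ : 1 - 2 * 1 = -1); last by ring.
by rewrite sqrrN expr1n subrr sqrtr0 scale0r addr0 scaleN1r.
Qed.

End Geometry.

(** * The tetrahedron *)

Theorem theorem1p1 (R : realType) (f : 'rV[R]_3 -> 'rV[R]_3)
    (fcont : {within sphere2 R, continuous f})
    (finj : {in sphere2 R &, injective f}) :
  exists x1 x2 x3 x4 : 'rV[R]_3,
    [/\ [/\ sphere2 R x1, sphere2 R x2, sphere2 R x3 & sphere2 R x4],
        uniq [:: x1; x2; x3; x4],
        [/\ eucl_dist (f x1) (f x2) = eucl_dist (f x2) (f x3),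
            eucl_dist (f x2) (f x3) = eucl_dist (f x3) (f x4)
          & eucl_dist (f x3) (f x4) = eucl_dist (f x4) (f x1)]
      & eucl_dist (f x1) (f x3) = eucl_dist (f x2) (f x4)].
Proof.
have [V [oV [m Vm] bV VS clV]] := bounded_region fcont finj.
pose S := f @` sphere2 R.
have bdS p : (closure V `\` V) p -> S p by move=> [/clV[]].
have cS : compact S by apply: continuous_compact => //; exact: sphere2_compact.
have clS : closed S by apply: compact_closed => //; exact: norm_hausdorff.
pose Z := [set z | S (m + z) /\ S (m - z)].
(* a chord with midpoint m: apply the planar statement to the half turn *)
have Z0 : Z !=set0.
  have uw : orthonormal (row3 (1 : R) 0 0) (row3 0 1 0).
    have [a0 a1 a2] := row3E (1 : R) 0 0; have [b0 b1 b2] := row3E (0 : R) 1 0.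
    by split; rewrite ?sqn_dot dot3E ?a0 ?a1 ?a2 ?b0 ?b1 ?b2; ring.
  have cN : continuous (fun y : 'rV[R]_2 => - y).
    by move=> y; exact: opp_continuous.
  have [y [/bdS Sy /bdS SNy]] := plane_boundary oV bV Vm uw cN (@sqnN R 2).
  by exists (plane (row3 1 0 0) (row3 0 1 0) y); split => //; rewrite -planeN.
have cZ : compact Z.
  apply: bounded_closed_compact.
    have /ex_strict_bound_gt0[M M0 SM] := compact_bounded cS.
    apply: (@bounded_normP _ _ _ (M + `|m|)) => z [/SM/= zM _].
    by rewrite -[z](addKr m) addrC (le_trans (ler_normB _ _))// lerD// ltW.
  apply: closedI; apply: preimage_closed => // z _.
    apply: (@cvgD _ _ _ (nbhs z) _ (fun=> m) id); first exact: cvg_cst.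
    exact: cvg_id.
  apply: (@cvgB _ _ _ (nbhs z) _ (fun=> m) id); first exact: cvg_cst.
  exact: cvg_id.
have csq : {within Z, continuous (@sqn R 3)}.
  by apply: continuous_subspaceT; exact: sqn_continuous.
have [z zZ zmin] := compact_EVT_min Z0 cZ csq.
have [Spz Smz] : Z z by rewrite inE in zZ.
have z0 : z != 0.
  by apply/eqP => z0; apply: VS Vm _; rewrite -[m]addr0 -z0.
have h0 : 0 < sqn z by rewrite sqn_gt0.
have [u [w [uw zu zw]]] := orthonormal_complement z0.
have [y [/bdS Sy /bdS STy]] := plane_boundary oV bV Vm uw (twist_continuous h0)
  (fun y => sqn_twist y h0).
(* inside the circle of radius |z|, y and its twist would be the ends of a
   chord with midpoint m shorter than z *)
have zy : sqn z <= sqn y.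
  rewrite leNgt; apply/negP => yz.
  have Zy : Z (plane u w y).
    by split => //; rewrite -planeN -(twist_small h0 (ltW yz)).
  by have := zmin (plane u w y); rewrite inE => /(_ Zy); rewrite sqn_plane// leNgt yz.
set a := plane u w y in Sy; set b := plane u w (twist (sqn z) y) in STy.
have sa : sqn a = sqn y by rewrite sqn_plane.
have sb : sqn b = sqn y by rewrite sqn_plane// sqn_twist.
have za : dot z a = 0 by exact: dot_plane.
have zb : dot z b = 0 by exact: dot_plane.
have ab : sqn (a - b) = 4 * sqn z by rewrite -planeB sqn_plane// twist_dist.
have zz : sqn (m + z - (m - z)) = 4 * sqn z.
  rewrite (_ : m + z - (m - z) = 2 *: z); first by rewrite sqnZ; ring.
  by apply/rowP => i; rewrite !mxE; ring.
have sideD c : dot z c = 0 -> sqn c = sqn y -> sqn (z + c) = sqn z + sqn y.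
  by move=> zc cy; rewrite sqnD_orthogonal// cy.
have sideB c : dot z c = 0 -> sqn c = sqn y -> sqn (z - c) = sqn z + sqn y.
  by move=> zc cy; apply: sideD; rewrite ?sqnN// -(scaleN1r c) dotZr zc mulr0.
case: Spz Smz Sy STy => x1 S1 f1 [x3 S3 f3] [x2 S2 f2] [x4 S4 f4].
have d12 : sqn (f x1 - f x2) = sqn z + sqn y.
  by rewrite f1 f2 opprD addrACA subrr add0r sideB.
have d23 : sqn (f x2 - f x3) = sqn z + sqn y.
  by rewrite f2 f3 opprB addrC addrA subrK sideD.
have d34 : sqn (f x3 - f x4) = sqn z + sqn y.
  by rewrite f3 f4 -sqnN opprB opprD opprK addrACA subrr add0r addrC sideD.
have d41 : sqn (f x4 - f x1) = sqn z + sqn y.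
  by rewrite f4 f1 opprD addrACA subrr add0r -sqnN opprB sideB.
have d13 : sqn (f x1 - f x3) = 4 * sqn z by rewrite f1 f3.
have d24 : sqn (f x2 - f x4) = 4 * sqn z.
  by rewrite f2 f4 opprD addrACA subrr add0r.
have zy0 : 0 < sqn z + sqn y by rewrite addr_gt0// (lt_le_trans h0).
have neq p q r : 0 < r -> sqn (f p - f q) = r -> p != q.
  by move=> r0 pq; apply: contraTneq r0 => pq'; rewrite -pq pq' subrr sqn_gt0 eqxx.
have four : 0 < 4 * sqn z by rewrite mulr_gt0.
exists x1, x2, x3, x4; split => //.
- rewrite /= !inE !negb_or (neq _ _ _ zy0 d12) (neq _ _ _ four d13).
  rewrite (neq _ _ _ zy0 d23) (neq _ _ _ four d24) (neq _ _ _ zy0 d34).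
  by rewrite eq_sym (neq _ _ _ zy0 d41).
- by rewrite !eucl_distE d12 d23 d34 d41.
- by rewrite !eucl_distE d13 d24.
Qed.
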